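(* With the setting of the context, for any $0<z<\delta\le\delta_1$, $$q_N(z,\delta):=\pi^{N,\delta}\{B_M^c(Nc,Nz)\}\le2\,\hat\zeta_N\big(z(1-e^{-1/2})/(2c_1(M))\big),$$ where $B_M^c(Nc,Nz)$ is the complement of $B_M(Nc,Nz)$.
   Context: Setting: for each $N$, $X^N$ is a pure jump Markov process on $S_N\subseteq\mathbb Z^d$, $N^{-1}S_N\subseteq\hat S$ closed; Assumption 1: finite $\mathcal J\subset\mathbb Z^d$, continuously differentiable $r_J:\hat S\to[0,\infty)$, only transitions $X\to X+J$ at rate $Nr_J(N^{-1}X)$; Assumption 2: every vector of $\mathbb Z^d$ is a finite sum of elements of $\mathcal J$; $F(y)=\sum_JJr_J(y)$; Assumption 3: $c$ in the interior of $\hat S$, $F(c)=0$, $r_J(c)>0$ for all $J$, $\rho>0$ with all eigenvalues of $\sum_JJ\nabla r_J(c)$ of real part $<-\rho$. $|\cdot|$ Euclidean norm; $\|x\|_M=(x^TMx)^{1/2}$; $B_M(z,\epsilon)=\{x:\|x-z\|_M\le\epsilon\}$; $c_1(M)^2$ largest eigenvalue of $M$. $M$ (real symmetric positive definite) and $\delta_0>0$ are fixed with $B_M(c,\delta_0)\subseteq\hat S$ such that every solution $y$ of $dy/dt=F(y)$ with $\|y(0)-c\|_M\le\delta_0$ satisfies $\frac d{dt}\|y(t)-c\|_M\le-\rho\|y(t)-c\|_M$, and for any two such solutions $\frac d{dt}\|y-z\|_M\le-\rho\|y-z\|_M$. Fix $\delta_1\in(0,\delta_0]$ and $r_0>0$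 with $r_J>r_0$ on $B_M(c,\delta_1)$. $\mathcal X_N(\delta)=\{X\in S_N:\|X-Nc\|_M\le N\delta\}$; $X^{N,\delta}$ is the chain on $\mathcal X_N(\delta)$ with the rates of $X^N$ except that transitions out of $\mathcal X_N(\delta)$ have rate zero; $\pi^{N,\delta}$ is its stationary distribution. $J^*=\max_J|J|$, $R^*(\mathcal K)=\sup_{y\in\mathcal K}\sum_Jr_J(y)$, $L(\mathcal K)=\sup_{y\in\mathcal K}|DF(y)|$, $\zeta_{N,T,\mathcal K}(z)=2d\exp\{-\frac{Nz}{2dJ^*}\min(1,\frac z{deTR^*(\mathcal K)J^*})\}$, $\hat\zeta_N(z)=\zeta_{N,\rho^{-1},B_M(c,\delta_0)}(ze^{-\rho^{-1}L(B_M(c,\delta_0))})$. *)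

(* Defs.v *)
From HB Require Import structures.
From mathcomp Require Import all_boot all_order all_algebra.
From mathcomp Require Import all_classical all_reals all_analysis.
From mathcomp Require Import complex.
Set Implicit Arguments. Unset Strict Implicit. Unset Printing Implicit Defensive.
Import Order.TTheory GRing.Theory Num.Theory.
Import numFieldNormedType.Exports.
Local Open Scope classical_set_scope.
Local Open Scope ring_scope.

Section Defs.
Variables (R : realType) (d : nat).

Definition intr_vec (X : 'rV[int]_d) : 'rV[R]_d := map_mx (fun k : int => k%:~R) X.

Definition euclid (x : 'rV[R]_d) : R := Num.sqrt (\sum_(i < d) x 0 i ^+ 2).

Definition mnorm (M : 'M[R]_d) (x : 'rV[R]_d) : R := Num.sqrt ((x *m M *m x^T) 0 0).

Definition ballM (M : 'M[R]_d) (z : 'rV[R]_d) (eps : R) : set 'rV[R]_d :=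
  [set x | mnorm M (x - z) <= eps].

Definition driftF (Js : seq 'rV[int]_d) (r : 'rV[int]_d -> 'rV[R]_d -> R)
  (y : 'rV[R]_d) : 'rV[R]_d := \sum_(J <- Js) r J y *: intr_vec J.

Definition gradmat (Js : seq 'rV[int]_d) (r : 'rV[int]_d -> 'rV[R]_d -> R)
  (y : 'rV[R]_d) : 'M[R]_d :=
  \matrix_(i, j) \sum_(J <- Js) (J 0 i)%:~R * 'D_(delta_mx 0 j) (r J) y.

Definition is_eigenvalue (A : 'M[R]_d) (l : R[i]) : Prop :=
  root (map_poly (real_complex R) (char_poly A)) l.

Definition lam_max (M : 'M[R]_d) : R := sup [set l : R | root (char_poly M) l].
Definition c1 (M : 'M[R]_d) : R := Num.sqrt (lam_max M).

Definition Jstar (Js : seq 'rV[int]_d) : R :=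
  \big[Num.max/0]_(J <- Js) euclid (intr_vec J).

Definition Rstar (Js : seq 'rV[int]_d) (r : 'rV[int]_d -> 'rV[R]_d -> R)
  (K : set 'rV[R]_d) : R :=
  sup [set \sum_(J <- Js) r J y | y in K].

(* operator norm (w.r.t. Euclidean norms) of a matrix acting on column vectors *)
Definition opnorm (A : 'M[R]_d) : R :=
  sup [set euclid (v *m A^T) | v in [set v : 'rV[R]_d | euclid v <= 1]].

Definition Lconst (Js : seq 'rV[int]_d) (r : 'rV[int]_d -> 'rV[R]_d -> R)
  (K : set 'rV[R]_d) : R :=
  sup [set opnorm (gradmat Js r y) | y in K].

Definition zeta (Js : seq 'rV[int]_d) (r : 'rV[int]_d -> 'rV[R]_d -> R)
  (N : nat) (T : R) (K : set 'rV[R]_d) (z : R) : R :=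
  2 * d%:R * expR (- ((N%:R * z) / (2 * d%:R * Jstar Js))
     * Num.min 1 (z / (d%:R * expR 1 * T * Rstar Js r K * Jstar Js))).

Definition zetahat (Js : seq 'rV[int]_d) (r : 'rV[int]_d -> 'rV[R]_d -> R)
  (M : 'M[R]_d) (c : 'rV[R]_d) (rho delta0 : R) (N : nat) (z : R) : R :=
  zeta Js r N rho^-1 (ballM M c delta0)
    (z * expR (- (rho^-1 * Lconst Js r (ballM M c delta0)))).

Definition Xset (S : nat -> set 'rV[int]_d) (M : 'M[R]_d) (c : 'rV[R]_d)
  (N : nat) (delta : R) : set 'rV[int]_d :=
  [set X | S N X /\ mnorm M (intr_vec X - N%:R *: c) <= N%:R * delta].

Definition rate (Js : seq 'rV[int]_d) (r : 'rV[int]_d -> 'rV[R]_d -> R)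
  (N : nat) (X Y : 'rV[int]_d) : R :=
  \sum_(J <- Js | X + J == Y) N%:R * r J ((N%:R)^-1 *: intr_vec X).

(* pi is a stationary distribution of the finite-state continuous-time
   Markov chain on Xs whose jump rates are q restricted to Xs (jumps leaving
   Xs suppressed): pi is a probability on Xs satisfying global balance
   pi Q = 0. *)
Definition is_stationary (Xs : set 'rV[int]_d) (q : 'rV[int]_d -> 'rV[int]_d -> R)
  (pi : 'rV[int]_d -> R) : Prop :=
  [/\ (forall X, Xs X -> 0 <= pi X),
      \sum_(X \in Xs) pi X = 1 &
      forall Y, Xs Y ->
        \sum_(X \in Xs) pi X * q X Y = pi Y * \sum_(Y' \in Xs) q Y Y'].

Definition is_ode_sol (F : 'rV[R]_d -> 'rV[R]_d) (y : R -> 'rV[R]_d) : Prop :=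
  (y x @[x --> 0^'+] --> y 0) /\
  forall t : R, 0 < t -> derivable y t 1 /\ 'D_1 y t = F (y t).

Definition contracts (rho : R) (g : R -> R) (t : R) : Prop :=
  derivable g t 1 /\ 'D_1 g t <= - rho * g t.

End Defs.

(* Main.v *)
Require Import Defs.
From HB Require Import structures.
From mathcomp Require Import all_boot all_order all_algebra.
From mathcomp Require Import all_classical all_reals all_analysis.
From mathcomp Require Import complex.
From mathcomp Require Import ring lra.
Import Order.TTheory GRing.Theory Num.Theory.
Import numFieldNormedType.Exports.
Local Open Scope classical_set_scope.
Local Open Scope ring_scope.

Set Implicit Arguments.
Unset Strict Implicit.
Unset Printing Implicit Defensive.

(** A Lyapunov argument on the finite chain replaces the path estimate.  If the
    drift satisfies <F(x), x - c>_M <= - rho |x - c|_M^2 on the ball, then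
    exp (sigma sqrt (|X - Nc|_M^2 + (Nz/2)^2)) is a Lyapunov function for the
    stationary chain: it is pushed down outside radius Nz/2, and a suppressed
    jump would only have increased it, so the boundary does no harm.  Averaging
    the generator against pi bounds the mass outside radius Nz.

    The contraction hypothesis speaks only of solutions of y' = F(y) that exist
    for all positive times, so the inequality for F needs such solutions.
    Replacing F by its composition with the radial projection onto a ball on
    whose boundary F points inward gives a bounded continuous field (Peano
    applies) whose solutions stay in the ball, hence solve y' = F(y).  Small
    balls for a Lyapunov norm of DF(c) are inward by the eigenvalue hypothesis;
    the largest M-ball on which the inequality holds cannot be smaller than
    B_M(c, delta0), because the inequality makes slightly larger balls inward. *)

(** * Quadratic forms *)

Definition bil {R : realType} {d : nat} (P : 'M[R]_d) (x y : 'rV[R]_d) : R :=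
  (x *m P *m y^T) 0 0.

Definition posdef {R : realType} {d : nat} (P : 'M[R]_d) : Prop :=
  forall x : 'rV[R]_d, x != 0 -> 0 < bil P x x.

Section BilinearForm.
Context {R : realType} {d : nat}.
Implicit Types (P : 'M[R]_d) (x y z : 'rV[R]_d).

Lemma bilDl P x y z : bil P (x + y) z = bil P x z + bil P y z.
Proof. by rewrite /bil !mulmxDl mxE. Qed.

Lemma bilDr P x y z : bil P x (y + z) = bil P x y + bil P x z.
Proof. by rewrite /bil linearD mulmxDr mxE. Qed.

Lemma bilZl P a x y : bil P (a *: x) y = a * bil P x y.
Proof. by rewrite /bil -!scalemxAl mxE. Qed.

Lemma bilZr P a x y : bil P x (a *: y) = a * bil P x y.
Proof. by rewrite /bil linearZ -scalemxAr mxE. Qed.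

Lemma bilNl P x y : bil P (- x) y = - bil P x y.
Proof. by rewrite -scaleN1r bilZl mulN1r. Qed.

Lemma bilNr P x y : bil P x (- y) = - bil P x y.
Proof. by rewrite -scaleN1r bilZr mulN1r. Qed.

Lemma bil0l P x : bil P 0 x = 0.
Proof. by rewrite -(scale0r 0) bilZl mul0r. Qed.

Lemma bil0r P x : bil P x 0 = 0.
Proof. by rewrite -(scale0r 0) bilZr mul0r. Qed.

Lemma bilC P x y : P^T = P -> bil P x y = bil P y x.
Proof.
move=> Psym; rewrite /bil.
have -> : x *m P *m y^T = (y *m P *m x^T)^T.
  by rewrite !trmx_mul trmxK Psym mulmxA.
by rewrite mxE.
Qed.

Lemma bil_suml P (I : Type) (s : seq I) (f : I -> 'rV[R]_d) y :
  bil P (\sum_(i <- s) f i) y = \sum_(i <- s) bil P (f i) y.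
Proof.
elim: s => [|i s IHs]; first by rewrite !big_nil bil0l.
by rewrite !big_cons bilDl IHs.
Qed.

Lemma bilE P x y : bil P x y = \sum_j \sum_i x 0 i * P i j * y 0 j.
Proof.
rewrite /bil mxE; apply: eq_bigr => j _; rewrite !mxE mulr_suml.
by apply: eq_bigr.
Qed.

Lemma bil_ge0 P x : posdef P -> 0 <= bil P x x.
Proof.
move=> Ppd; have [->|/Ppd/ltW//] := eqVneq x 0.
by rewrite bil0l.
Qed.

Lemma mnormE P x : mnorm P x = Num.sqrt (bil P x x).
Proof. by []. Qed.

Lemma mnorm_ge0 P x : 0 <= mnorm P x.
Proof. exact: sqrtr_ge0. Qed.

Lemma sqr_mnorm P x : posdef P -> mnorm P x ^+ 2 = bil P x x.
Proof. by move=> Ppd; rewrite sqr_sqrtr// bil_ge0. Qed.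

Lemma mnorm_gt0 P x : posdef P -> x != 0 -> 0 < mnorm P x.
Proof. by move=> Ppd x0; rewrite sqrtr_gt0; exact: Ppd. Qed.

Lemma mnorm0 P : mnorm P 0 = 0.
Proof. by rewrite mnormE bil0l sqrtr0. Qed.

Lemma mnormZ P a x : 0 <= a -> mnorm P (a *: x) = a * mnorm P x.
Proof.
move=> a0; rewrite !mnormE bilZl bilZr mulrA -expr2 sqrtrM ?sqr_ge0//.
by rewrite sqrtr_sqr ger0_norm.
Qed.

Lemma mnorm_le P x (e : R) : 0 <= e -> (mnorm P x <= e) = (bil P x x <= e ^+ 2).
Proof.
move=> e0; rewrite mnormE.
have [b0|b0] := leP 0 (bil P x x).
  by rewrite -(ler_pXn2r (n := 2)) ?nnegrE ?sqrtr_ge0// sqr_sqrtr.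
rewrite ler0_sqrtr ?(ltW b0)// e0.
by rewrite (le_trans (ltW b0)) ?sqr_ge0.
Qed.

Lemma cauchy_schwarz P x y : P^T = P -> posdef P ->
  bil P x y <= mnorm P x * mnorm P y.
Proof.
move=> Psym Ppd.
have [->|x0] := eqVneq x 0; first by rewrite bil0l mnorm0 mul0r.
have [->|y0] := eqVneq y 0; first by rewrite bil0r mnorm0 mulr0.
set a := mnorm P x; set b := mnorm P y.
have a0 : 0 < a by exact: mnorm_gt0.
have b0 : 0 < b by exact: mnorm_gt0.
have := bil_ge0 (b *: x - a *: y) Ppd.
rewrite !(bilDl, bilDr, bilNl, bilNr, bilZl, bilZr) (bilC y x)//.
rewrite -!sqr_mnorm// -/a -/b => H.
have : 0 <= (a * b) * (a * b - bil P x y).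
  rewrite -(pmulr_rge0 _ (ltr0n R 2)).
  by apply: le_trans H _; rewrite le_eqVlt; apply/orP; left; apply/eqP; ring.
by rewrite pmulr_rge0 ?mulr_gt0// subr_ge0.
Qed.

Lemma normr_bil_le P x y : P^T = P -> posdef P ->
  `|bil P x y| <= mnorm P x * mnorm P y.
Proof.
move=> Psym Ppd; rewrite ler_norml cauchy_schwarz// andbT lerNl -bilNl.
have -> : mnorm P x = mnorm P (- x) by rewrite !mnormE bilNl bilNr opprK.
exact: cauchy_schwarz.
Qed.

Lemma cvg_coord (T : Type) (F : set_system T) {FF : Filter F}
    (f : T -> 'rV[R]_d) (a : 'rV[R]_d) (i : 'I_d) :
  f @ F --> a -> (fun t => f t 0 i) @ F --> a 0 i.
Proof.
move=> fa; apply: (@cvg_comp _ _ _ f (fun v : 'rV[R]_d => v 0 i) _ _ _ fa).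
exact: coord_continuous.
Qed.

Lemma bil_cvg P (T : Type) (F : set_system T) {FF : Filter F}
    (f g : T -> 'rV[R]_d) a b :
  f @ F --> a -> g @ F --> b -> (fun t => bil P (f t) (g t)) @ F --> bil P a b.
Proof.
move=> fa gb; rewrite bilE.
under eq_fun do rewrite bilE.
apply: cvg_big => [|j _]; first exact: add_continuous.
apply: cvg_big => [|i _]; first exact: add_continuous.
by apply: cvgM; [apply: cvgM; [exact: cvg_coord|exact: cvg_cst]|exact: cvg_coord].
Qed.

Lemma mnorm_cvg P (T : Type) (F : set_system T) {FF : Filter F}
    (f : T -> 'rV[R]_d) a :
  f @ F --> a -> (fun t => mnorm P (f t)) @ F --> mnorm P a.
Proof.
move=> fa.
exact: (cvg_comp _ _ (bil_cvg fa fa) (@sqrt_continuous R _)).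
Qed.

Lemma is_derive_bil P (f : R -> 'rV[R]_d) (c : 'rV[R]_d) (t : R) :
  P^T = P -> derivable f t 1 ->
  is_derive t 1 (fun s => bil P (f s - c) (f s - c))
    (2 * bil P ('D_1 f t) (f t - c)).
Proof.
move=> Psym df.
have dfi i : is_derive t 1 (fun s => (f s - c) 0 i) (('D_1 f t) 0 i).
  have -> : (fun s => (f s - c) 0 i) = (fun s => f s 0 i) - cst (c 0 i).
    by apply/funext => s; rewrite !mxE.
  rewrite -[X in is_derive _ _ _ X]subr0; apply: is_deriveB.
  rewrite derive_mx// mxE; apply: derivableP; exact: (derivable_mxP _ _ _).1.
have -> : (fun s => bil P (f s - c) (f s - c)) =
   \sum_j \sum_i (fun s => P i j * ((f s - c) 0 i * (f s - c) 0 j)).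
  apply/funext => s; rewrite bilE fct_sumE; apply: eq_bigr => j _.
  by rewrite fct_sumE; apply: eq_bigr => i _; ring.
have -> : 2 * bil P ('D_1 f t) (f t - c) = \sum_j \sum_i P i j *
    ((f t - c) 0 i * ('D_1 f t) 0 j + (f t - c) 0 j * ('D_1 f t) 0 i).
  rewrite mulr2n mulrDl mul1r {1}bilC// !bilE -big_split; apply: eq_bigr => j _.
  by rewrite -big_split; apply: eq_bigr => i _ /=; ring.
apply: is_derive_sum => j; apply: is_derive_sum => i.
by apply: is_deriveZ; apply: is_deriveM.
Qed.

Lemma continuous_bounded_closed_compact (K : set 'rV[R]_d) :
  closed K -> (exists r, forall x, K x -> `|x| <= r) -> compact K.
Proof.
move=> cK [r Kr]; apply: bounded_closed_compact => //.
exists r; split; first exact: num_real.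
by move=> s rs x Kx; exact: le_trans (Kr _ Kx) (ltW rs).
Qed.

Lemma posdef_coercive P : posdef P ->
  exists2 k : R, 0 < k & forall x, k * `|x| ^+ 2 <= bil P x x.
Proof.
move=> Ppd; pose K := [set x : 'rV[R]_d | `|x| = 1].
have cK : compact K.
  apply: continuous_bounded_closed_compact; last by exists 1 => x ->.
  apply: (@preimage_closed _ _ (fun x : 'rV[R]_d => `|x|) [set t | t = 1]).
    by move=> x _; exact: norm_continuous.
  exact: closed_eq.
have contK : {within K, continuous (fun x => bil P x x)}.
  apply: continuous_subspaceT => x.
  by apply: (bil_cvg (F := nbhs x) (f := id) (g := id)); exact: cvg_id.
have [[x0 Kx0]|K0] := pselect (K !=set0); last first.
  exists 1 => // x; have [->|xn0] := eqVneq x 0.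
    by rewrite normr0 bil0l expr0n mulr0.
  exfalso; apply: K0; exists (`|x|^-1 *: x).
  by rewrite /K/= normrZ normrV ?unitfE ?normr_eq0// normr_id mulVf// normr_eq0.
have [m Km min] := EVT_min_rV (ex_intro _ _ Kx0) cK contK.
rewrite inE in Km.
exists (bil P m m).
  by apply: Ppd; rewrite -normr_eq0 Km oner_neq0.
move=> x; have [->|xn0] := eqVneq x 0.
  by rewrite normr0 bil0l expr0n mulr0.
have nx0 : 0 < `|x| by rewrite normr_gt0.
have := min (`|x|^-1 *: x).
rewrite inE /K/= normrZ normrV ?unitfE ?gt_eqF// normr_id mulVf ?gt_eqF//.
move=> /(_ erefl); rewrite bilZl bilZr mulrA -expr2 exprVn.
by rewrite -ler_pdivlMr ?exprn_gt0// mulrC.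
Qed.

Lemma ballM_compact P c (e : R) : posdef P -> compact (ballM P c e).
Proof.
move=> Ppd; apply: continuous_bounded_closed_compact.
  apply: (@preimage_closed _ _ (fun x : 'rV[R]_d => mnorm P (x - c)) [set t | t <= e]).
    move=> x _; apply: (mnorm_cvg (F := nbhs x) (f := fun y => y - c)).
    by apply: cvgB; [exact: cvg_id|exact: cvg_cst].
  exact: closed_le.
have [k k0 kP] := posdef_coercive Ppd.
exists (`|c| + (`|e| + 1) / Num.min 1 k) => x; rewrite /ballM/= => xe.
rewrite -(subrK c x) (le_trans (ler_normD _ _))// addrC lerD2l.
have m0 : 0 < Num.min 1 k by rewrite lt_min ltr01.
rewrite ler_pdivlMr//.
have [->|xc] := eqVneq (x - c) 0; first by rewrite normr0 mul0r addr_ge0.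
have e0 : 0 < e by apply: lt_le_trans xe; exact: mnorm_gt0.
rewrite (gtr0_norm e0).
rewrite -(ler_pXn2r (n := 2)) ?nnegrE ?mulr_ge0 ?addr_ge0// ?(ltW m0)// ?(ltW e0)//.
rewrite exprMn mulrC.
apply: (@le_trans _ _ (k * `|x - c| ^+ 2)).
  rewrite ler_wpM2r ?sqr_ge0// expr2.
  apply: (@le_trans _ _ (1 * Num.min 1 k)).
    by rewrite ler_wpM2r ?(ltW m0)// ge_min lexx.
  by rewrite mul1r ge_min lexx orbT.
apply: le_trans (kP _) _; move: xe; rewrite mnorm_le ?(ltW e0)// => /le_trans; apply.
by rewrite ler_pXn2r ?nnegrE ?addr_ge0// ?(ltW e0)// lerDl.
Qed.

End BilinearForm.
(** * Peano's theorem *)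

Lemma fmap_ultra (T U : Type) (f : T -> U) (F : set_system T) :
  UltraFilter F -> UltraFilter (f @ F).
Proof.
move=> UF; constructor; first exact: fmap_proper_filter.
move=> G GF FG; apply/seteqP; split => // A GA.
have [//|FnA] := in_ultra_setVsetC (f @^-1` A) UF.
have GnA : G (~` A) by apply: FG.
have : G set0 by rewrite -(setICr A); exact: filterI.
by move=> /filter_not_empty.
Qed.

Section EulerPolygons.
Context {R : realType} {d : nat} (F : 'rV[R]_d -> 'rV[R]_d) (x0 : 'rV[R]_d).

Definition euler_iter (m k : nat) : 'rV[R]_d :=
  iter k (fun v => v + m.+1%:R^-1 *: F v) x0.

Definition euler_step (m : nat) (t : R) : 'rV[R]_d :=
  euler_iter m (Num.truncn (t * m.+1%:R)).

Lemma euler_iter_approx m k n (w : 'rV[R]_d) (e : R) :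
  (forall i, (k <= i < k + n)%N -> `|F (euler_iter m i) - w| <= e) ->
  `|euler_iter m (k + n) - euler_iter m k - (n%:R / m.+1%:R) *: w|
    <= n%:R / m.+1%:R * e.
Proof.
elim: n => [_|n IHn H]; first by rewrite addn0 subrr mul0r scale0r subr0 normr0 mul0r.
rewrite addnS /euler_iter iterS -/(euler_iter m (k + n)) -/(euler_iter m k).
have -> : euler_iter m (k + n) + m.+1%:R^-1 *: F (euler_iter m (k + n)) -
     euler_iter m k - (n.+1%:R / m.+1%:R) *: w =
   (euler_iter m (k + n) - euler_iter m k - (n%:R / m.+1%:R) *: w) +
   m.+1%:R^-1 *: (F (euler_iter m (k + n)) - w).
  rewrite scalerBr -[n.+1%:R]natr1 mulrDl mul1r scalerDl opprD.
  rewrite !addrA; congr (_ - _); rewrite -!addrA; congr (_ + _).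
  by rewrite [LHS]addrC -!addrA.
apply: le_trans (ler_normD _ _) _.
rewrite -[n.+1%:R]natr1 mulrDl mul1r mulrDl lerD//.
  by apply: IHn => i /andP[ki ikn]; apply: H; rewrite ki addnS ltnS ltnW.
rewrite normrZ ger0_norm ?invr_ge0// ler_wpM2l ?invr_ge0//.
by apply: H; rewrite leq_addr addnS ltnSn.
Qed.

Lemma truncn_scale_diff (m : nat) (a b : R) : 0 <= a -> a <= b ->
  let k := Num.truncn (a * m.+1%:R) in let l := Num.truncn (b * m.+1%:R) in
  (k <= l)%N /\ `|(l - k)%:R / m.+1%:R - (b - a)| <= m.+1%:R^-1.
Proof.
move=> a0 ab k l.
have m0 : 0 < m.+1%:R :> R by [].
have kl : (k <= l)%N by apply: le_truncn; rewrite ler_pM2r.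
split => //.
have /andP[k1 k2] : k%:R <= a * m.+1%:R < k.+1%:R.
  by apply: truncn_itv; rewrite mulr_ge0.
have /andP[l1 l2] : l%:R <= b * m.+1%:R < l.+1%:R.
  by apply: truncn_itv; rewrite mulr_ge0// (le_trans a0).
rewrite -(ler_pM2r m0) mulVf ?gt_eqF// -[X in _ * X](gtr0_norm m0) -normrM.
rewrite mulrBl mulfVK ?gt_eqF// natrB// mulrBl ler_norml.
move: k1 k2 l1 l2; rewrite -[k.+1%:R]natr1 -[l.+1%:R]natr1.
move: (a * _) (b * _) (k%:R) (l%:R) => A B K L *; apply/andP; split; lra.
Qed.

Lemma euler_step_approx m (a b : R) (w : 'rV[R]_d) (e : R) :
  0 <= a -> a <= b -> 0 <= e ->
  (forall i, (Num.truncn (a * m.+1%:R) <= i < Num.truncn (b * m.+1%:R))%N ->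
     `|F (euler_iter m i) - w| <= e) ->
  `|euler_step m b - euler_step m a - (b - a) *: w|
    <= (b - a + m.+1%:R^-1) * e + m.+1%:R^-1 * `|w|.
Proof.
move=> a0 ab e0; rewrite /euler_step.
have [] := truncn_scale_diff m a0 ab.
set k := Num.truncn _; set l := Num.truncn _ => kl dist H.
have := @euler_iter_approx m k (l - k) w e; rewrite subnKC// => /(_ H) {}H.
have -> : euler_iter m l - euler_iter m k - (b - a) *: w =
  (euler_iter m l - euler_iter m k - ((l - k)%:R / m.+1%:R) *: w) +
  ((l - k)%:R / m.+1%:R - (b - a)) *: w.
  by rewrite [in RHS]scalerBl addrA subrK.
apply: le_trans (ler_normD _ _) _; apply: lerD.
  apply: le_trans H _; rewrite ler_wpM2r//.
  by rewrite addrC -lerBlDr; move: dist; rewrite ler_norml => /andP[].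
by rewrite normrZ ler_wpM2r.
Qed.

Context (B : R) (B0 : 0 < B) (FB : forall x, `|F x| <= B).

Lemma euler_iter_lip m k l : (k <= l)%N ->
  `|euler_iter m l - euler_iter m k| <= (l - k)%:R / m.+1%:R * B.
Proof.
move=> kl; have := @euler_iter_approx m k (l - k) 0 B.
rewrite subnKC// scaler0 subr0; apply => i _.
by rewrite subr0.
Qed.

Lemma euler_iter_near_step m (a b t : R) i :
  0 <= a -> a <= b -> a <= t <= b ->
  (Num.truncn (a * m.+1%:R) <= i <= Num.truncn (b * m.+1%:R))%N ->
  `|euler_iter m i - euler_step m t| <= (b - a + m.+1%:R^-1) * B.
Proof.
move=> a0 ab /andP[at_ tb] /andP[ai ib]; rewrite /euler_step.
have [kl dist] := truncn_scale_diff m a0 ab.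
have am : (Num.truncn (a * m.+1%:R) <= Num.truncn (t * m.+1%:R))%N.
  by apply: le_truncn; rewrite ler_pM2r.
have bm : (Num.truncn (t * m.+1%:R) <= Num.truncn (b * m.+1%:R))%N.
  by apply: le_truncn; rewrite ler_pM2r.
have main p : (p <= Num.truncn (b * m.+1%:R) - Num.truncn (a * m.+1%:R))%N ->
    p%:R / m.+1%:R * B <= (b - a + m.+1%:R^-1) * B.
  move=> pk; rewrite ler_wpM2r ?(ltW B0)//.
  apply: (@le_trans _ _ ((Num.truncn (b * m.+1%:R) - Num.truncn (a * m.+1%:R))%:R / m.+1%:R)).
    by rewrite ler_wpM2r ?invr_ge0// ler_nat.
  by rewrite addrC -lerBlDr; move: dist; rewrite ler_norml => /andP[].
have [it|ti] := leqP i (Num.truncn (t * m.+1%:R)).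
  rewrite distrC; apply: le_trans (euler_iter_lip _ it) _; apply: main.
  by rewrite leq_sub.
apply: le_trans (euler_iter_lip _ (ltnW ti)) _; apply: main.
by rewrite leq_sub.
Qed.

End EulerPolygons.
Section Peano.
Context {R : realType} {d : nat} (F : 'rV[R]_d -> 'rV[R]_d) (x0 : 'rV[R]_d).
Context (B : R) (B0 : 0 < B) (FB : forall x, `|F x| <= B).

Lemma euler_step_bounded m t : `|euler_step F x0 m t - x0| <= (`|t| + 1) * B.
Proof.
have [t0|t0] := leP 0 t; last first.
  rewrite /euler_step (truncn0Pn _ _) /=; last first.
    rewrite -ltNge (@le_lt_trans _ _ 0)// pmulr_lle0// ltW//.
  by rewrite subrr normr0 mulr_ge0 ?addr_ge0 ?(ltW B0).
have := @euler_iter_near_step _ _ F x0 B B0 FB m 0 t t 0.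
rewrite lexx t0 mul0r truncn0 /= -normrN opprB => /(_ (lexx _) isT isT (leq0n _)) /le_trans; apply.
rewrite ler_wpM2r ?(ltW B0)// subr0 ger0_norm// lerD2l invf_le1// ler1n//.
Qed.

(* The solution is the pointwise limit, along an ultrafilter on the step sizes,
   of the piecewise constant Euler approximations: neither equicontinuity nor
   a convergent subsequence is needed. *)
Lemma peano : continuous F ->
  exists2 y : R -> 'rV[R]_d, y 0 = x0 & is_ode_sol F y.
Proof.
move=> cF.
have [U [UU UN]] := @ultraFilterLemma nat \oo _.
have PU : ProperFilter U by exact: ultra_proper.
have lim_exists t : exists l : 'rV[R]_d, euler_step F x0 m t @[m --> U] --> l.
  pose K := [set v : 'rV[R]_d | `|v - x0| <= (`|t| + 1) * B].
  have cK : compact K.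
    apply: continuous_bounded_closed_compact.
      apply: (@preimage_closed _ _ (fun v : 'rV[R]_d => `|v - x0|) [set s | s <= (`|t| + 1) * B]).
        move=> x _; have H : (fun v : 'rV[R]_d => v - x0) @ nbhs x --> x - x0.
          exact: (cvgB (@cvg_id _ (nbhs x)) (@cvg_cst _ x0 _ (nbhs x) _)).
        exact: cvg_norm H.
      exact: closed_le.
    exists (`|x0| + (`|t| + 1) * B) => x Kx.
    by rewrite -(subrK x0 x) addrC (le_trans (ler_normD _ _))// lerD2l.
  have UK : (euler_step F x0 m t @[m --> U]) K.
    by apply: (@filterE _ U _ (fun m => K (euler_step F x0 m t))) => m; exact: euler_step_bounded.
  move: cK; rewrite compact_ultra => /(_ _ (fmap_ultra _ UU) UK) [l [_ ?]].
  by exists l.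
pose y t := sval (cid (lim_exists t)).
have yl t : euler_step F x0 m t @[m --> U] --> y t by exact: svalP (cid (lim_exists t)).
have y0 : y 0 = x0.
  apply: (@cvg_unique _ (@norm_hausdorff R 'rV[R]_d) (euler_step F x0 m 0 @[m --> U])).
    exact: yl.
  have -> : (fun m => euler_step F x0 m 0) = cst x0.
    by apply/funext => m; rewrite /euler_step mul0r truncn0.
  exact: cvg_cst.
have Uinv (e : R) : 0 < e -> \forall m \near U, m.+1%:R^-1 < e.
  move=> e0; apply: UN; exact: (near_infty_natSinv_lt (PosNum e0)).
have inv0 : (fun m => m.+1%:R^-1 : R) @ U --> (0 : R).
  apply/cvgrPdist_lt => e e0; apply: filterS (Uinv _ e0) => m.
  by rewrite sub0r normrN ger0_norm ?invr_ge0.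
have main t e : 0 <= t -> 0 < e -> exists2 eta, 0 < eta & forall s, 0 <= s ->
    `|s - t| < eta -> `|y s - y t - (s - t) *: F (y t)| <= `|s - t| * e.
  move=> t0 e0.
  have /cvgrPdist_le/(_ _ e0) := cF (y t).
  rewrite -nbhs_nearE => /nbhs_ballP[r /= r0 rF].
  exists (r / (4 * B)) => [|s s0 st]; first by rewrite divr_gt0 ?mulr_gt0.
  pose a := Num.min s t; pose b := Num.max s t.
  have a0 : 0 <= a by rewrite le_min s0.
  have ab : a <= b by rewrite le_max ge_min lexx.
  have bale : b - a = `|s - t|.
    rewrite /a /b; case: (leP s t) => H.
      by rewrite ler0_norm ?subr_le0// opprB.
    by rewrite ger0_norm ?subr_ge0 ?(ltW H).
  have atb : a <= t <= b by rewrite le_max ge_min !lexx !orbT.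
  suff : `|y b - y a - (b - a) *: F (y t)| <= (b - a) * e.
    rewrite -bale /a /b; case: (leP s t) => // H.
    have -> : y s - y t - (s - t) *: F (y t) = - (y t - y s - (t - s) *: F (y t)).
      by rewrite -(opprB t s) scaleNr opprK opprD opprB opprK.
    by rewrite normrN.
  have H1 : (fun m => `|euler_step F x0 m b - euler_step F x0 m a - (b - a) *: F (y t)|)
      @ U --> `|y b - y a - (b - a) *: F (y t)|.
    have H : (fun m => euler_step F x0 m b - euler_step F x0 m a - (b - a) *: F (y t))
        @ U --> y b - y a - (b - a) *: F (y t).
      by apply: cvgB; [apply: cvgB; exact: yl|exact: cvg_cst].
    exact: cvg_norm H.
  have H2 : (fun m => (b - a + m.+1%:R^-1) * e + m.+1%:R^-1 * `|F (y t)|) @ U -->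
      (b - a + 0) * e + 0 * `|F (y t)|.
    apply: cvgD; apply: cvgM; try exact: cvg_cst; last exact: inv0.
    by apply: cvgD; [exact: cvg_cst|exact: inv0].
  rewrite addr0 mul0r addr0 in H2.
  apply: (ler_cvg_to H1 H2).
  have r2 : 0 < r / 2 by rewrite divr_gt0.
  have r4 : 0 < r / (4 * B) by rewrite divr_gt0 ?mulr_gt0.
  have /cvgrPdist_lt/(_ _ r2) close := yl t.
  near=> m.
  apply: euler_step_approx => //; first exact: ltW.
  move=> i /andP[i1 i2].
  rewrite distrC; apply: rF.
  rewrite -ball_normE /ball_ /=.
  have near1 : `|euler_iter F x0 m i - euler_step F x0 m t| <= (b - a + m.+1%:R^-1) * B.
    by apply: euler_iter_near_step => //; rewrite i1 ltnW.
  have mr : m.+1%:R^-1 < r / (4 * B) by near: m; exact: Uinv.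
  have mc : `|y t - euler_step F x0 m t| < r / 2 by near: m; exact: close.
  have : (b - a + m.+1%:R^-1) * B < r / 2.
    have -> : r / 2 = (r / (4 * B) + r / (4 * B)) * B.
      by field; rewrite gt_eqF.
    by rewrite ltr_pM2r// ltrD// bale.
  rewrite (_ : y t - _ = (y t - euler_step F x0 m t) - (euler_iter F x0 m i - euler_step F x0 m t)); last first.
    by rewrite opprB addrA subrK.
  move=> lt2; apply: le_lt_trans (ler_normB _ _) _.
  by rewrite (splitr r) ltrD// (le_lt_trans near1).
exists y => //; split.
  apply/cvgrPdist_le => e e0.
  have [eta eta0 H] := main 0 1 (lexx _) ltr01.
  have C0 : 0 < 1 + `|F (y 0)| by rewrite ltr_pwDl.
  near=> s.
  have s0 : 0 < s by [].
  have se : s < eta by near: s; exact: nbhs_right_lt.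
  have se2 : s < e / (1 + `|F (y 0)|).
    by near: s; apply: nbhs_right_lt; rewrite divr_gt0.
  have := H s (ltW s0); rewrite subr0 (gtr0_norm s0) => /(_ se); rewrite mulr1 => H1.
  rewrite distrC -(subrK (s *: F (y 0)) (y s - y 0)).
  apply: le_trans (ler_normD _ _) _.
  rewrite normrZ (gtr0_norm s0).
  apply: (@le_trans _ _ (s * (1 + `|F (y 0)|))); last by rewrite -ler_pdivlMr// ltW.
  by rewrite mulrDr mulr1 lerD2r.
move=> t t0.
have D : (fun h => h^-1 *: (y (h *: 1 + t) - y t)) @ 0^' --> F (y t).
  apply/cvgrPdist_le => e e0.
  have [eta eta0 H] := main t e (ltW t0) e0.
  near=> h.
  have h0 : h != 0 by near: h; exact: nbhs_dnbhs_neq.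
  have he : `|h| < eta by near: h; exact: dnbhs0_lt.
  have ht : `|h| < t by near: h; exact: dnbhs0_lt.
  have hp : 0 < `|h| by rewrite normr_gt0.
  have := H (h + t); rewrite addrK => /(_ _ he).
  have -> : 0 <= h + t by move: ht; rewrite ltr_norml => /andP[]; lra.
  move=> /(_ isT) {}H.
  rewrite distrC -(ler_pM2l hp) -normrZ scalerBr scalerA divff// scale1r.
  by rewrite [h *: 1]mulr1.
split.
  by apply/cvg_ex; exists (F (y t)).
exact: (cvg_lim _ D).
Unshelve. all: by end_near. Qed.

End Peano.
(** * Contraction of the drift *)

Section InvariantBall.
Context {R : realType} {d : nat} (P : 'M[R]_d) (c : 'rV[R]_d) (e : R).
Context (Psym : P^T = P) (Ppd : posdef P) (e0 : 0 < e).

Definition ballM_proj (x : 'rV[R]_d) : 'rV[R]_d :=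
  c + (e / Num.max e (mnorm P (x - c))) *: (x - c).

Let max_gt0 x : 0 < Num.max e (mnorm P (x - c)).
Proof. by rewrite lt_max e0. Qed.

Lemma ballM_proj_in x : ballM P c e (ballM_proj x).
Proof.
rewrite /ballM /ballM_proj/= addrC addKr mnormZ; last first.
  by rewrite divr_ge0 ?ltW.
by rewrite mulrAC ler_pdivrMr// ler_pM2l// le_max lexx orbT.
Qed.

Lemma ballM_proj_id x : ballM P c e x -> ballM_proj x = x.
Proof.
rewrite /ballM /ballM_proj/= => xe.
by rewrite (max_idPl xe) divff ?gt_eqF// scale1r addrC subrK.
Qed.

Lemma subr_ballM_proj x :
  x - c = (Num.max e (mnorm P (x - c)) / e) *: (ballM_proj x - c).
Proof.
rewrite /ballM_proj [c + _]addrC addrK scalerA.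
by rewrite mulrA mulfVK ?gt_eqF// divff ?gt_eqF// scale1r.
Qed.

Lemma ballM_proj_continuous : continuous ballM_proj.
Proof.
move=> x.
have xc : (fun y : 'rV[R]_d => y - c) @ nbhs x --> x - c.
  exact: (cvgB (@cvg_id _ (nbhs x)) (@cvg_cst _ c _ (nbhs x) _)).
have mc : {for x, continuous (fun y : 'rV[R]_d => mnorm P (y - c) : R^o)}.
  exact: (mnorm_cvg (P := P) xc).
have Mc := @continuous_max _ _ (cst e) _ x (@cst_continuous _ _ e x) mc.
have m0 : Num.max e (mnorm P (x - c)) != 0 by rewrite gt_eqF.
have Vc : (fun y : 'rV[R]_d => e / Num.max e (mnorm P (y - c))) @ nbhs x -->
    e / Num.max e (mnorm P (x - c)).
  exact: (cvgM (@cvg_cst _ e _ (nbhs x) _) (cvgV m0 Mc)).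
exact: (cvgD (@cvg_cst _ c _ (nbhs x) _) (cvgZ Vc xc)).
Qed.

Context (F : 'rV[R]_d -> 'rV[R]_d).
Context (cF : forall x, ballM P c e x -> {for x, continuous F}).

Lemma comp_ballM_proj_continuous : continuous (F \o ballM_proj).
Proof.
move=> x; apply: continuous_comp; first exact: ballM_proj_continuous.
exact/cF/ballM_proj_in.
Qed.

Lemma comp_ballM_proj_bounded :
  exists2 B, 0 < B & forall x, `|(F \o ballM_proj) x| <= B.
Proof.
have ccF : {within ballM P c e, continuous F}.
  apply: continuous_in_subspaceT => x; rewrite inE; exact: cF.
have [B [_ HB]] := compact_bounded (continuous_compact ccF (ballM_compact Ppd)).
have B1 : B < `|B| + 1 by rewrite ltr_pwDr ?ler_norm.
exists (`|B| + 1) => [|x]; first by rewrite ltr_wpDl.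
by apply: (HB _ B1); exists (ballM_proj x) => //; exact: ballM_proj_in.
Qed.

Lemma invariant_solution (x0 : 'rV[R]_d) :
  (forall x, ballM P c e x -> bil P (F x) (x - c) <= 0) -> ballM P c e x0 ->
  exists y, [/\ y 0 = x0, is_ode_sol F y & forall t, 0 <= t -> ballM P c e (y t)].
Proof.
move=> inward x0in.
have [B B0 FB] := comp_ballM_proj_bounded.
have [y y0 [y_right y_sol]] := peano x0 B0 FB comp_ballM_proj_continuous.
have inward' x : bil P ((F \o ballM_proj) x) (x - c) <= 0.
  rewrite [x - c]subr_ballM_proj bilZr pmulr_rle0 ?divr_gt0//.
  exact/inward/ballM_proj_in.
have stay (t : R) : 0 <= t -> ballM P c e (y t).
  pose V t := bil P (y t - c) (y t - c).
  have dV (s : R) : 0 < s -> is_derive s 1 V (2 * bil P ((F \o ballM_proj) (y s)) (y s - c)).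
    by move=> s0; have [dy <-] := y_sol s s0; exact: is_derive_bil.
  have V0 (t1 : R) : 0 <= t1 -> V t1 <= V 0.
    apply: (@ler0_derive1_nincry _ V 0) => //.
    - by move=> s; rewrite in_itv/= andbT => /dV[].
    - move=> s; rewrite in_itv/= andbT => s0; have ? := dV s s0.
      by rewrite derive1E derive_val pmulr_rle0.
    - apply/continuous_within_itvcyP; split.
        move=> s; rewrite in_itv/= andbT => s0; have [ds _] := dV s s0.
        exact/differentiable_continuous/derivable1_diffP.
      have H : y x - c @[x --> 0^'+] --> y 0 - c.
        by apply: cvgB => //; exact: cvg_cst.
      exact: (bil_cvg (P := P) H H).
  move=> t0; rewrite /ballM/= mnorm_le ?(ltW e0)//.
  apply: le_trans (V0 t t0) _; rewrite /V y0.
  by rewrite -mnorm_le ?(ltW e0).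
exists y; split => //; split => // t t0.
have [dy ->] := y_sol t t0; split => //=.
by rewrite ballM_proj_id//; apply: stay; exact: ltW.
Qed.

Context (M : 'M[R]_d) (rho : R) (Msym : M^T = M) (Mpd : posdef M).

Lemma contraction_on_invariant_ball (delta0 : R) :
  (forall x, ballM P c e x -> bil P (F x) (x - c) <= 0) ->
  (forall x, ballM P c e x -> mnorm M (x - c) <= delta0) ->
  (forall y, is_ode_sol F y -> mnorm M (y 0 - c) <= delta0 ->
     forall t, 0 < t -> contracts rho (fun s => mnorm M (y s - c)) t) ->
  forall x, ballM P c e x ->
    bil M (F x) (x - c) <= - rho * bil M (x - c) (x - c).
Proof.
move=> inward sub contr x xin.
have [y [y0 [y_right y_sol] stay]] := invariant_solution inward xin.
have ineq (t : R) : 0 < t ->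
    bil M (F (y t)) (y t - c) <= - rho * bil M (y t - c) (y t - c).
  move=> t0; have [dy Dy] := y_sol t t0.
  have y0d : mnorm M (y 0 - c) <= delta0 by rewrite y0; exact: sub.
  have [dm Dm] := contr y (conj y_right y_sol) y0d t t0.
  have := is_derive_bil c Msym dy; rewrite Dy => D1.
  have D2 := is_deriveM (derivableP dm) (derivableP dm).
  have eqf : (fun s => bil M (y s - c) (y s - c)) =
      ((fun s => mnorm M (y s - c)) * (fun s => mnorm M (y s - c)))%R.
    by apply/funext => s; rewrite -sqr_mnorm.
  rewrite -eqf in D2.
  have E := derive_val (is_derive := D1); rewrite (derive_val (is_derive := D2)) in E.
  have E2 : bil M (F (y t)) (y t - c) =
      mnorm M (y t - c) * 'D_1 (fun s => mnorm M (y s - c)) t.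
    have : 2 * bil M (F (y t)) (y t - c) =
      2 * (mnorm M (y t - c) * 'D_1 (fun s => mnorm M (y s - c)) t).
      rewrite -E; rewrite mulr2n mulrDl mul1r; by [].
    by apply: mulfI.
  rewrite E2 -sqr_mnorm// expr2 mulrA [- rho * _]mulrC -mulrA.
  by rewrite ler_wpM2l// mnorm_ge0.
have cyc : y t - c @[t --> 0^'+] --> x - c.
  by rewrite -y0; apply: cvgB => //; exact: cvg_cst.
have cFy : F (y t) @[t --> 0^'+] --> F x.
  rewrite y0 in y_right; exact: (cvg_comp _ _ y_right (cF xin)).
apply: (ler_cvg_to (bil_cvg (P := M) cFy cyc)).
  apply: cvgM; first exact: cvg_cst.
  exact: (bil_cvg (P := M) cyc cyc).
near=> t; exact: ineq.
Unshelve. all: by end_near. Qed.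

End InvariantBall.
Section ContractionOnBall.
Context {R : realType} {d : nat} (M : 'M[R]_d) (c : 'rV[R]_d) (rho delta0 : R).
Context (Msym : M^T = M) (Mpd : posdef M) (rho0 : 0 < rho) (delta0_gt0 : 0 < delta0).
Context (F : 'rV[R]_d -> 'rV[R]_d).
Context (cF : forall x, ballM M c delta0 x -> {for x, continuous F}).
Context (contr : forall y, is_ode_sol F y -> mnorm M (y 0 - c) <= delta0 ->
  forall t, 0 < t -> contracts rho (fun s => mnorm M (y s - c)) t).

Lemma contraction_on_ball (s0 : R) : 0 < s0 ->
  (forall x, ballM M c s0 x ->
     bil M (F x) (x - c) <= - rho * bil M (x - c) (x - c)) ->
  forall x, ballM M c delta0 x ->
    bil M (F x) (x - c) <= - rho * bil M (x - c) (x - c).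
Proof.
move=> s0_gt0 Hs0.
have nrho_le0 x : - rho * bil M (x - c) (x - c) <= 0.
  by rewrite mulNr oppr_le0 mulr_ge0 ?(ltW rho0)// bil_ge0.
pose G := F \o ballM_proj M c delta0.
have cG : continuous G by exact: comp_ballM_proj_continuous.
have GF x : ballM M c delta0 x -> G x = F x.
  by move=> xin; rewrite /G/= ballM_proj_id.
(* On a minimizer x1 of the norm over Bad the inequality is the limit of the
   inequality on the smaller balls, which are invariant. *)
pose Bad := [set x | ballM M c delta0 x /\ s0 <= mnorm M (x - c) /\
  0 <= bil M (G x) (x - c) + rho / 2 * bil M (x - c) (x - c)].
have subc (x : 'rV[R]_d) : (fun y : 'rV[R]_d => y - c) @ nbhs x --> x - c.
  exact: (cvgB (@cvg_id _ (nbhs x)) (@cvg_cst _ c _ (nbhs x) _)).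
have cm : continuous (fun x : 'rV[R]_d => mnorm M (x - c)).
  by move=> x; exact: (mnorm_cvg (P := M) (subc x)).
have cg : continuous (fun x : 'rV[R]_d =>
    bil M (G x) (x - c) + rho / 2 * bil M (x - c) (x - c)).
  move=> x; have FFx : Filter (nbhs x) by exact: nbhs_filter.
  have H1 := bil_cvg (P := M) (cG x) (subc x).
  have H2 := bil_cvg (P := M) (subc x) (subc x).
  have H3 : (fun x => rho / 2 * bil M (x - c) (x - c)) @ nbhs x -->
      rho / 2 * bil M (x - c) (x - c).
    by apply: cvgM; [exact: cvg_cst|exact: H2].
  exact: (cvgD (H1 FFx) H3).
have [[z0 Bad0]|Bad0] := pselect (Bad !=set0); last first.
  apply: (@contraction_on_invariant_ball _ _ M c delta0 Msym Mpd _ F cF M rho Msym Mpd delta0) => //.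
  move=> x xin; have [xs0|xs0] := ltP (mnorm M (x - c)) s0.
    by apply: le_trans (Hs0 x (ltW xs0)) (nrho_le0 x).
  rewrite -GF//; apply/negP => /negP; rewrite -ltNge => gt0.
  apply: Bad0; exists x; do !split => //.
  by rewrite addr_ge0 ?(ltW gt0)// mulr_ge0 ?divr_ge0 ?(ltW rho0)// bil_ge0.
have cBad : compact Bad.
  apply: (subclosed_compact _ (ballM_compact (c := c) (e := delta0) Mpd)); last by move=> x [].
  have -> : Bad = ballM M c delta0 `&` ((fun x => mnorm M (x - c)) @^-1` [set t | s0 <= t]
     `&` (fun x => bil M (G x) (x - c) + rho / 2 * bil M (x - c) (x - c)) @^-1` [set t | 0 <= t]).
    by apply/seteqP; split.
  apply: closedI; first exact: (compact_closed (@norm_hausdorff _ _) (ballM_compact Mpd)).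
  by apply: closedI; apply: preimage_closed => //; exact: closed_ge.
have [x1 Bx1 minx1] := EVT_min_rV (ex_intro _ _ Bad0) cBad (continuous_subspaceT cm).
move: Bx1; rewrite inE => -[x1in [x1s0 x1bad]].
have s1_gt0 : 0 < mnorm M (x1 - c) by exact: lt_le_trans x1s0.
have below x : mnorm M (x - c) < mnorm M (x1 - c) ->
    bil M (F x) (x - c) <= - rho * bil M (x - c) (x - c).
  move=> xs1; have xin : ballM M c delta0 x.
    exact: le_trans (ltW xs1) x1in.
  have [->|xc] := eqVneq (x - c) 0; first by rewrite !bil0r mulr0.
  have e0 : 0 < mnorm M (x - c) by exact: mnorm_gt0.
  have sub z : ballM M c (mnorm M (x - c)) z -> ballM M c delta0 z.
    by move=> zx; exact: le_trans zx xin.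
  apply: (@contraction_on_invariant_ball _ _ M c _ Msym Mpd e0 F _ M rho Msym Mpd delta0) => //.
  - by move=> z /sub/cF.
  - move=> z zx; have [zs0|zs0] := ltP (mnorm M (z - c)) s0.
      by apply: le_trans (Hs0 z (ltW zs0)) (nrho_le0 z).
    apply/negP => /negP; rewrite -ltNge => gt0.
    have : z \in Bad.
      rewrite inE; split; first exact: sub.
      split => //; rewrite GF; last exact: sub.
      by rewrite addr_ge0 ?(ltW gt0)// mulr_ge0 ?divr_ge0 ?(ltW rho0)// bil_ge0.
    by move=> /minx1; apply/negP; rewrite -ltNge; exact: le_lt_trans zx xs1.
  - by rewrite /ballM/=.
exfalso; suff : bil M (F x1) (x1 - c) <= - rho * bil M (x1 - c) (x1 - c).
  move: x1bad; rewrite GF// -sqr_mnorm//.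
  have : 0 < rho * mnorm M (x1 - c) ^+ 2 by rewrite mulr_gt0 ?exprn_gt0.
  rewrite mulrAC mulNr; move: (rho * _) (bil _ _ _) => a b; lra.
pose l (t : R) : 'rV[R]_d := c + t *: (x1 - c).
have l1 : l 1 = x1 by rewrite /l scale1r addrC subrK.
have lc : l t @[t --> 1^'-] --> x1.
  rewrite -l1; apply: cvg_at_left_filter.
  exact: (cvgD (@cvg_cst _ c _ (nbhs (1 : R)) _) (cvgZ (@cvg_id _ (nbhs (1 : R))) (@cvg_cst _ (x1 - c) _ (nbhs (1 : R)) _))).
have lcc : l t - c @[t --> 1^'-] --> x1 - c.
  exact: (cvgB lc (@cvg_cst _ c _ (1^'-) _)).
have Flc : F (l t) @[t --> 1^'-] --> F x1.
  exact: (cvg_comp _ _ lc (cF x1in)).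
apply: (ler_cvg_to (bil_cvg (P := M) Flc lcc)).
  apply: cvgM; first exact: cvg_cst.
  exact: (bil_cvg (P := M) lcc lcc).
near=> t; apply: below.
have t0 : 0 < t by near: t; exact: nbhs_left_gt.
have t1 : t < 1 by [].
by rewrite /l addrC addKr mnormZ ?(ltW t0)// gtr_pMl.
Unshelve. all: by end_near. Qed.

End ContractionOnBall.
(** * Lyapunov matrices *)

Section Lyapunov.
Context {R : realType}.

Lemma Re_sum (I : Type) (s : seq I) (f : I -> R[i]) :
  complex.Re (\sum_(i <- s) f i) = \sum_(i <- s) complex.Re (f i).
Proof.
elim: s => [|i s IHs]; first by rewrite !big_nil.
by rewrite !big_cons -IHs; case: (f i) (\sum_(j <- s) f j) => [? ?] [? ?].
Qed.

Lemma Im_sum (I : Type) (s : seq I) (f : I -> R[i]) :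
  complex.Im (\sum_(i <- s) f i) = \sum_(i <- s) complex.Im (f i).
Proof.
elim: s => [|i s IHs]; first by rewrite !big_nil.
by rewrite !big_cons -IHs; case: (f i) (\sum_(j <- s) f j) => [? ?] [? ?].
Qed.

Lemma char_poly_tr (n : nat) (A : 'M[R]_n) : char_poly A^T = char_poly A.
Proof.
rewrite /char_poly -[RHS]det_tr; congr (\det _).
by apply/matrixP => i j; rewrite !mxE eq_sym.
Qed.

(* Real and imaginary parts of the Schur form A Q = Q T. *)
Lemma real_trigonalization (n : nat) (A : 'M[R]_n.+1) :
  (forall l, is_eigenvalue A l -> complex.Re l < 0) ->
  exists Q1 Q2 T1 T2 : 'M[R]_n.+1,
  [/\ A *m Q1 = Q1 *m T1 - Q2 *m T2, A *m Q2 = Q1 *m T2 + Q2 *m T1,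
      forall x : 'rV[R]_n.+1, x *m Q1 = 0 -> x *m Q2 = 0 -> x = 0,
      forall i j : 'I_n.+1, (i < j)%N -> T1 i j = 0 /\ T2 i j = 0 &
      forall i, T1 i i < 0].
Proof.
move=> Aeig; pose AC := map_mx (real_complex R) A.
have [Q /unitarymx_unit Qu] := @Schur R[i] _ AC isT.
rewrite /similar_to conjumx// => /is_trig_mxP.
have [T TE] : exists T, T = Q *m AC *m invmx Q by eexists.
rewrite -TE => Ttrig.
have [S SE] : exists S, S = invmx Q by eexists.
have ST : AC *m S = S *m T by rewrite TE SE !mulmxA mulVmx// mul1mx.
have STij i j : (AC *m S) i j = (S *m T) i j by rewrite ST.
exists (map_mx (@complex.Re R) S), (map_mx (@complex.Im R) S),
  (map_mx (@complex.Re R) T), (map_mx (@complex.Im R) T); split.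
- apply/matrixP => i j; rewrite !mxE.
  have /(congr1 (@complex.Re R)) := STij i j; rewrite !mxE !Re_sum => H.
  transitivity (\sum_k complex.Re (AC i k * S k j)).
    by apply: eq_bigr => k _; rewrite !mxE; case: (S k j) => a b /=; rewrite mul0r subr0.
  rewrite H -sumrB; apply: eq_bigr => k _; rewrite !mxE.
  by case: (S i k) => a1 b1; case: (T k j) => a2 b2 /=.
- apply/matrixP => i j; rewrite !mxE.
  have /(congr1 (@complex.Im R)) := STij i j; rewrite !mxE !Im_sum => H.
  transitivity (\sum_k complex.Im (AC i k * S k j)).
    by apply: eq_bigr => k _; rewrite !mxE; case: (S k j) => a b /=; rewrite mul0r addr0.
  rewrite H -big_split; apply: eq_bigr => k _; rewrite !mxE.
  by case: (S i k) => a1 b1; case: (T k j) => a2 b2 /=.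
- move=> x xS1 xS2.
  have xS : map_mx (real_complex R) x *m S = 0.
    apply/rowP => j; rewrite !mxE.
    have /(congr1 (fun v : 'rV[R]_n.+1 => v 0 j)) := xS1.
    have /(congr1 (fun v : 'rV[R]_n.+1 => v 0 j)) := xS2.
    rewrite !mxE => H2 H1; apply/eqP; rewrite eq_complex Re_sum Im_sum /=.
    rewrite -[X in _ == X]H1 -[X in _ && (_ == X)]H2; apply/andP; split; apply/eqP;
      apply: eq_bigr => k _; rewrite !mxE; case: (S k j) => a b /=;
      by rewrite mul0r ?subr0 ?addr0.
  have : map_mx (real_complex R) x = 0.
    by rewrite -[LHS](mulmxKV Qu) -SE xS mul0mx.
  move=> /rowP x0; apply/rowP => j; have := x0 j; rewrite !mxE => -[].
  exact.
- by move=> i j ij; rewrite !mxE Ttrig.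
- move=> i; rewrite mxE; apply: Aeig.
  rewrite /is_eigenvalue map_char_poly -eigenvalue_root_char.
  have : eigenvalue T (T i i).
    rewrite eigenvalue_root_char char_poly_trig; last exact/is_trig_mxP.
    rewrite -(big_map (fun i => T i i) xpredT (fun a => 'X - a%:P)) root_prod_XsubC.
    by apply/mapP; exists i => //; rewrite mem_index_enum.
  move=> /eigenvalueP[v vT v0]; apply/eigenvalueP; exists (v *m Q).
    have -> : v *m Q *m AC = v *m T *m Q by rewrite TE !mulmxA mulmxKV.
    by rewrite vT -scalemxAl.
  by apply: contraNneq v0 => vQ; rewrite -[v](mulmxK Qu) vQ mul0mx.
Qed.


Lemma lyapunov_matrix (n : nat) (A : 'M[R]_n.+1) :
  (forall l, is_eigenvalue A l -> complex.Re l < 0) ->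
  exists P : 'M[R]_n.+1, [/\ P^T = P, posdef P &
    forall x, x != 0 -> bil P (x *m A) x < 0].
Proof.
move=> /real_trigonalization[Q1 [Q2 [T1 [T2 [AQ1 AQ2 Qinj Ttrig Tdiag]]]]].
pose t i j := `|T1 i j| + `|T2 i j|.
pose C := \sum_i \sum_j t i j.
have t0 i j : 0 <= t i j by rewrite addr_ge0.
have tC i j : t i j <= C.
  rewrite /C (bigD1 i)//= (bigD1 j)//= -addrA lerDl.
  by rewrite addr_ge0// sumr_ge0// => k _; rewrite sumr_ge0.
have C0 : 0 <= C by apply: le_trans (t0 0 0) (tC 0 0).
pose K := 1 + \sum_i C * n.+1%:R / - T1 i i.
have Kterm i : 0 <= C * n.+1%:R / - T1 i i.
  by rewrite divr_ge0 ?mulr_ge0// oppr_ge0 ltW.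
have K1 : 1 <= K by rewrite lerDl sumr_ge0.
have K0 : 0 < K by exact: lt_le_trans K1.
have KT i : T1 i i + C * n.+1%:R / K < 0.
  have : C * n.+1%:R / - T1 i i < K.
    rewrite /K (bigD1 i)//= addrCA ltrDl (lt_le_trans ltr01)// lerDl.
    by rewrite sumr_ge0.
  have Ti : 0 < - T1 i i by rewrite oppr_gt0.
  by rewrite ltr_pdivrMr// addrC -ltrBrDr sub0r ltr_pdivrMr// [K * _]mulrC.
(* These weights make the off-diagonal part of the triangular form negligible. *)
pose w (i : 'I_n.+1) := K ^+ (2 * i).
have w0 i : 0 < w i by rewrite exprn_gt0.
pose W := diag_mx (\row_i w i).
have Wsym : W^T = W by rewrite tr_diag_mx.
pose P := Q1 *m W *m Q1^T + Q2 *m W *m Q2^T.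
have bilW x y : bil W x y = \sum_i w i * x 0 i * y 0 i.
  rewrite bilE; apply: eq_bigr => i _; rewrite (bigD1 i)//= big1 => [|j ji].
    by rewrite !mxE eqxx mulr1n addr0 [x 0 i * _]mulrC.
  by rewrite !mxE (negbTE ji) mulr0n mulr0 mul0r.
have bilP x y : bil P x y = bil W (x *m Q1) (y *m Q1) + bil W (x *m Q2) (y *m Q2).
  by rewrite /bil /P mulmxDr mulmxDl mxE !trmx_mul !mulmxA.
pose N (x : 'rV[R]_n.+1) i := (x *m Q1) 0 i ^+ 2 + (x *m Q2) 0 i ^+ 2.
have N0 x i : 0 <= N x i by rewrite addr_ge0 ?sqr_ge0.
have sumN x : x != 0 -> exists i, 0 < N x i.
  move=> x0; apply/not_existsP => H; move/eqP: x0; apply; apply: Qinj; apply/rowP => i.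
  - have := H i; move/negP; rewrite -leNgt [RHS]mxE => Ni.
    apply/eqP; rewrite -sqrf_eq0 eq_le sqr_ge0 andbT (le_trans _ Ni)//.
    by rewrite lerDl sqr_ge0.
  - have := H i; move/negP; rewrite -leNgt [RHS]mxE => Ni.
    apply/eqP; rewrite -sqrf_eq0 eq_le sqr_ge0 andbT (le_trans _ Ni)//.
    by rewrite lerDr sqr_ge0.
exists P; split.
- by rewrite /P linearD/= !trmx_mul !trmxK Wsym !mulmxA.
- move=> x /sumN[i Ni]; rewrite bilP !bilW -big_split/=.
  have E k : w k * (x *m Q1) 0 k * (x *m Q1) 0 k + w k * (x *m Q2) 0 k * (x *m Q2) 0 k
     = w k * N x k by rewrite /N; ring.
  under eq_bigr do rewrite E.
  by rewrite (bigD1 i)//= ltr_pwDl ?mulr_gt0// sumr_ge0// => k _; rewrite mulr_ge0 ?(ltW (w0 k)).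
- move=> x x0; rewrite bilP -!mulmxA AQ1 AQ2 mulmxBr mulmxDr !mulmxA.
  pose v1 i := (x *m Q1) 0 i; pose v2 i := (x *m Q2) 0 i.
  pose term i j := w i * ((v1 j * T1 j i - v2 j * T2 j i) * v1 i
     + (v1 j * T2 j i + v2 j * T1 j i) * v2 i).
  have -> : bil W (x *m Q1 *m T1 - x *m Q2 *m T2) (x *m Q1) +
      bil W (x *m Q1 *m T2 + x *m Q2 *m T1) (x *m Q2) = \sum_i \sum_j term i j.
    rewrite !bilW -big_split; apply: eq_bigr => i _ /=.
    rewrite -!mulrA -mulrDr -mulr_sumr; congr (_ * _).
    rewrite big_split/= -!mulr_suml; congr (_ * _ + _ * _).
      by rewrite !mxE -sumrB; apply: eq_bigr.
    by rewrite !mxE -big_split.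
  have wN0 k : 0 <= w k * N x k by rewrite mulr_ge0// ltW.
  have CK0 : 0 <= C / (2 * K) by rewrite divr_ge0// mulr_ge0// ltW.
  have offdiag i j : j != i ->
      term i j <= C / (2 * K) * (w i * N x i + w j * N x j).
    move=> ji; have [lt_ji|] := ltnP j i.
      have [T1ji T2ji] := Ttrig _ _ lt_ji.
      rewrite /term T1ji T2ji !mulr0 subr0 addr0 !mul0r addr0 mulr0.
      by rewrite mulr_ge0// addr_ge0.
    move=> ij; have lt_ij : (i < j)%N.
      by rewrite ltn_neqAle ij andbT; move: ji; rewrite -val_eqE eq_sym.
    have wij : w i * K ^+ 2 <= w j.
      by rewrite /w -exprD ler_weXn2l// -mulnSr leq_mul.
    have young : K * ((v1 j * T1 j i - v2 j * T2 j i) * v1 i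
       + (v1 j * T2 j i + v2 j * T1 j i) * v2 i) <= C * (N x i + K ^+ 2 * N x j) / 2.
      apply: (@le_trans _ _ (t j i * (N x i + K ^+ 2 * N x j) / 2)); last first.
        rewrite ler_wpM2r ?invr_ge0//; apply: ler_wpM2r => //.
        by rewrite addr_ge0// mulr_ge0// exprn_ge0// ltW.
      have am (s p q p' q' : R) : s * (p * p' + q * q') <=
          `|s| * ((p ^+ 2 + q ^+ 2) + (p' ^+ 2 + q' ^+ 2)) / 2.
        apply: (@le_trans _ _ (`|s| * `|p * p' + q * q'|)).
          by rewrite -normrM ler_norm.
        rewrite -mulrA ler_wpM2l// ler_norml; apply/andP; split.
          by have := sqr_ge0 (p + p'); have := sqr_ge0 (q + q'); rewrite !expr2; lra.
        by have := sqr_ge0 (p - p'); have := sqr_ge0 (q - q'); rewrite !expr2; lra.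
      have H1 := am (T1 j i) (K * v1 j) (K * v2 j) (v1 i) (v2 i).
      have H2 := am (T2 j i) (K * v1 j) (- (K * v2 j)) (v2 i) (v1 i).
      rewrite /t /N -/(v1 i) -/(v2 i) -/(v1 j) -/(v2 j).
      apply: le_trans (_ : _ <= `|T1 j i| * (((K * v1 j) ^+ 2 + (K * v2 j) ^+ 2) + (v1 i ^+ 2 + v2 i ^+ 2)) / 2 + `|T2 j i| * (((K * v1 j) ^+ 2 + (- (K * v2 j)) ^+ 2) + (v2 i ^+ 2 + v1 i ^+ 2)) / 2) _.
        by apply: le_trans (lerD H1 H2); rewrite le_eqVlt; apply/orP; left; apply/eqP; ring.
      by rewrite le_eqVlt; apply/orP; left; apply/eqP; field.
    rewrite /term -(ler_pM2l K0) mulrCA.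
    apply: le_trans (ler_wpM2l (ltW (w0 i)) young) _.
    have -> : K * (C / (2 * K) * (w i * N x i + w j * N x j)) =
        C * (w i * N x i + w j * N x j) / 2 by field; rewrite gt_eqF.
    rewrite mulrA ler_pM2r// mulrCA ler_wpM2l// mulrDr lerD2l mulrA.
    by rewrite ler_wpM2r.
  have diag i : term i i = T1 i i * (w i * N x i).
    by rewrite /term /N -/(v1 i) -/(v2 i); ring.
  pose Z := \sum_i w i * N x i.
  have bound : \sum_i \sum_j term i j <=
      \sum_i (T1 i i * (w i * N x i) + \sum_j C / (2 * K) * (w i * N x i + w j * N x j)).
    apply: ler_sum => i _; rewrite (bigD1 i)//= diag lerD2l.
    rewrite [leRHS](bigD1 i)//= -[leLHS]add0r lerD//.
      by rewrite mulr_ge0// addr_ge0.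
    by apply: ler_sum => j ji; exact: offdiag.
  apply: le_lt_trans bound _.
  have -> : \sum_i (T1 i i * (w i * N x i) +
      \sum_j C / (2 * K) * (w i * N x i + w j * N x j)) =
    \sum_i (T1 i i + C * n.+1%:R / K) * (w i * N x i).
    transitivity (\sum_i T1 i i * (w i * N x i) + C / (2 * K) * (n.+1%:R * Z + n.+1%:R * Z)).
      rewrite big_split/=; congr (_ + _).
      under eq_bigr do rewrite -mulr_sumr big_split/= sumr_const card_ord.
      rewrite -mulr_sumr big_split/= sumr_const card_ord -/Z; congr (_ * (_ + _)).
        by rewrite sumrMnl mulr_natl.
      by rewrite mulr_natl.
    have -> : C / (2 * K) * (n.+1%:R * Z + n.+1%:R * Z) = C * n.+1%:R / K * Z.
      by field; rewrite gt_eqF.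
    by rewrite /Z mulr_sumr -big_split/=; apply: eq_bigr => i _; rewrite mulrDl.
  have [i Ni] := sumN x x0.
  rewrite (bigD1 i)//= -[ltRHS]addr0 ltr_leD//.
    by rewrite nmulr_rlt0 ?mulr_gt0.
  by apply: sumr_le0 => j _; rewrite nmulr_rle0.
Qed.

End Lyapunov.
Section Linearization.
Context {R : realType} {d : nat}.
Implicit Types (P M : 'M[R]_d) (c x y : 'rV[R]_d).

Lemma norm_coord_le x i : `|x 0 i| <= `|x|.
Proof.
rewrite [leRHS]/Num.Def.normr/= mx_normrE.
exact: (le_bigmax _ (fun ij : 'I_1 * 'I_d => `|x ij.1 ij.2|) (0, i)).
Qed.

Lemma bil_bounded P : exists2 C, 0 < C & forall x y, `|bil P x y| <= C * (`|x| * `|y|).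
Proof.
exists (1 + \sum_j \sum_i `|P i j|).
  by rewrite ltr_pwDl// sumr_ge0// => j _; rewrite sumr_ge0.
move=> x y; rewrite bilE.
apply: (@le_trans _ _ ((\sum_j \sum_i `|P i j|) * (`|x| * `|y|))); last first.
  by rewrite ler_wpM2r ?mulr_ge0// lerDr.
rewrite (le_trans (ler_norm_sum _ _ _))// mulr_suml ler_sum// => j _.
rewrite (le_trans (ler_norm_sum _ _ _))// mulr_suml ler_sum// => i _.
rewrite !normrM [`|x 0 i| * _]mulrC -mulrA ler_wpM2l//.
by rewrite ler_pM ?norm_coord_le.
Qed.

Lemma ballM_nbhs P c (e : R) : 0 < e -> nbhs c (ballM P c e).
Proof.
move=> e0; have subc : (fun y : 'rV[R]_d => y - c) @ nbhs c --> c - c.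
  exact: (cvgB (@cvg_id _ (nbhs c)) (@cvg_cst _ c _ (nbhs c) _)).
have mc : (fun y : 'rV[R]_d => mnorm P (y - c)) @ nbhs c --> mnorm P (c - c).
  exact: (mnorm_cvg (P := P) subc).
rewrite subrr mnorm0 in mc.
exact: (cvgr_le _ mc _ e0).
Qed.

Lemma nbhs_ballM P c (A : set 'rV[R]_d) : posdef P -> nbhs c A ->
  exists2 e, 0 < e & ballM P c e `<=` A.
Proof.
move=> Ppd /nbhs_ballP[r /= r0 rA].
have [k k0 kP] := posdef_coercive Ppd.
exists (Num.sqrt k * (r / 2)); first by rewrite mulr_gt0 ?sqrtr_gt0 ?divr_gt0.
move=> x; rewrite /ballM/= mnorm_le; last by rewrite mulr_ge0 ?sqrtr_ge0 ?divr_ge0// ltW.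
rewrite exprMn sqr_sqrtr ?(ltW k0)// => /(le_trans (kP _)).
rewrite ler_pM2l// ler_pXn2r ?nnegrE ?divr_ge0 ?(ltW r0)// => xr.
apply: rA; rewrite -ball_normE/= distrC (le_lt_trans xr)//.
by rewrite ltr_pdivrMr// mulr_natr mulr2n ltrDr.
Qed.

Lemma differentiable_taylor (f : 'rV[R]_d -> R) c (eps : R) :
  differentiable f c -> 0 < eps ->
  \forall x \near c,
    `|f x - f c - \sum_j (x - c) 0 j * 'D_(delta_mx 0 j) f c| <= eps * `|x - c|.
Proof.
move=> df eps0.
have lin h : 'd f c h = \sum_j h 0 j * 'D_(delta_mx 0 j) f c.
  rewrite {1}(row_sum_delta h) linear_sum; apply: eq_bigr => j _.
  by rewrite linearZ/= deriveE.
have [_ /eqaddoP/(_ _ eps0) H] := (diff_locallyP _ _).1 df.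
have subc : (fun y : 'rV[R]_d => y - c) @ nbhs c --> (0 : 'rV[R]_d).
  rewrite -[X in _ --> X](subrr c).
  exact: (cvgB (@cvg_id _ (nbhs c)) (@cvg_cst _ c _ (nbhs c) _)).
apply: (@filterS _ (nbhs c) _ _ _ _ (subc _ H)) => x /=.
by rewrite /= !fctE /= subrK lin opprD addrA.
Qed.

Lemma driftF_taylor (Js : seq 'rV[int]_d) (r : 'rV[int]_d -> 'rV[R]_d -> R) c (eps : R) :
  (forall J, J \in Js -> differentiable (r J) c) -> 0 < eps ->
  \forall x \near c,
    `|driftF Js r x - driftF Js r c - (x - c) *m (gradmat Js r c)^T|
      <= eps * `|x - c|.
Proof.
move=> dr eps0.
have near_all (C : R) : 0 < C -> \forall x \near c, forall J, J \in Js ->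
    `|r J x - r J c - \sum_j (x - c) 0 j * 'D_(delta_mx 0 j) (r J) c| <= eps / C * `|x - c|.
  move=> C0; elim: Js dr => [|J Js IHs] dr; first by near=> x.
  have dJ : differentiable (r J) c by apply: dr; rewrite mem_head.
  have T := differentiable_taylor dJ (divr_gt0 eps0 C0).
  have {}IHs := IHs (fun K KJs => dr K (mem_behead (s := J :: Js) KJs)).
  near=> x => K; rewrite inE => /predU1P[->|].
    by near: x; exact: T.
  by move: K; near: x; exact: IHs.
pose C : R := 1 + \sum_(J <- Js) `|intr_vec R J|.
have C0 : 0 < C by rewrite ltr_pwDl// sumr_ge0.
have H := near_all C C0.
apply: filterS H => x H.
have -> : driftF Js r x - driftF Js r c - (x - c) *m (gradmat Js r c)^T =
    \sum_(J <- Js) (r J x - r J c - \sum_j (x - c) 0 j * 'D_(delta_mx 0 j) (r J) c)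
       *: intr_vec R J.
  have grad j i : (gradmat Js r c)^T j i =
      \sum_(J <- Js) (J 0 i)%:~R * 'D_(delta_mx 0 j) (r J) c by rewrite !mxE.
  move: (x - c) (gradmat Js r c)^T grad => h G grad.
  apply/rowP => i; rewrite /driftF !mxE !summxE -sumrB.
  have -> : \sum_j h 0 j * G j i =
      \sum_(J <- Js) (\sum_j h 0 j * 'D_(delta_mx 0 j) (r J) c) * (J 0 i)%:~R.
    under [RHS]eq_bigr do rewrite mulr_suml.
    rewrite exchange_big/=; apply: eq_bigr => j _; rewrite grad mulr_sumr.
    by apply: eq_bigr => J _; ring.
  by rewrite -sumrB; apply: eq_bigr => J _; rewrite !mxE !mulrBl.
rewrite (le_trans (ler_norm_sum _ _ _))//.
apply: (@le_trans _ _ (\sum_(J <- Js) eps / C * `|x - c| * `|intr_vec R J|)).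
  rewrite big_seq [leRHS]big_seq; apply: ler_sum => J JJs.
  by rewrite normrZ ler_wpM2r// H.
rewrite -mulr_sumr; apply: (@le_trans _ _ (eps / C * `|x - c| * C)).
  apply: ler_wpM2l; first by rewrite mulr_ge0// divr_ge0// ltW.
  by rewrite /C lerDr.
by rewrite mulrAC mulfVK ?gt_eqF.
Unshelve. all: by end_near. Qed.

Lemma inward_near_stable_point (Js : seq 'rV[int]_d) (r : 'rV[int]_d -> 'rV[R]_d -> R) P c :
  (forall J, J \in Js -> differentiable (r J) c) -> driftF Js r c = 0 ->
  (forall x, x != 0 -> bil P (x *m (gradmat Js r c)^T) x < 0) ->
  \forall x \near c, bil P (driftF Js r x) (x - c) <= 0.
Proof.
move=> dr Fc0 Pneg; set A := (gradmat Js r c)^T in Pneg *.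
have pd : posdef (- (A *m P)).
  move=> x /Pneg Hx; rewrite /bil mulmxN mulNmx mxE oppr_gt0 mulmxA.
  exact: Hx.
have [k k0 kA] := posdef_coercive pd.
have [C C0 PC] := bil_bounded P.
have := driftF_taylor dr (divr_gt0 k0 C0); apply: filterS => x.
rewrite Fc0 subr0 -/A => H.
rewrite -(subrK ((x - c) *m A) (driftF Js r x)) bilDl.
have := kA (x - c).
rewrite {1}/bil mulmxN mulNmx mxE mulmxA -/(bil P ((x - c) *m A) (x - c)).
have : bil P (driftF Js r x - (x - c) *m A) (x - c) <= k * `|x - c| ^+ 2.
  apply: le_trans (ler_norm _) _; apply: le_trans (PC _ _) _.
  apply: (@le_trans _ _ (C * (k / C * `|x - c| * `|x - c|))).
    by rewrite ler_wpM2l ?(ltW C0)// ler_wpM2r.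
  by rewrite le_eqVlt; apply/orP; left; apply/eqP; field; rewrite gt_eqF.
lra.
Qed.

End Linearization.

Lemma drift_contraction (R : realType) (n : nat) (Js : seq 'rV[int]_n.+1)
    (r : 'rV[int]_n.+1 -> 'rV[R]_n.+1 -> R) (M : 'M[R]_n.+1) (c : 'rV[R]_n.+1)
    (rho delta0 : R) :
  (forall J y, J \in Js -> ballM M c delta0 y -> differentiable (r J) y) ->
  driftF Js r c = 0 -> 0 < rho ->
  (forall l, is_eigenvalue (gradmat Js r c) l -> complex.Re l < - rho) ->
  M^T = M -> posdef M -> 0 < delta0 ->
  (forall y, is_ode_sol (driftF Js r) y -> mnorm M (y 0 - c) <= delta0 ->
     forall t, 0 < t -> contracts rho (fun s => mnorm M (y s - c)) t) ->
  forall x, ballM M c delta0 x ->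
    bil M (driftF Js r x) (x - c) <= - rho * bil M (x - c) (x - c).
Proof.
move=> dr Fc0 rho0 eig Msym Mpd delta0_gt0 contr.
have c_in : ballM M c delta0 c by rewrite /ballM/= subrr mnorm0 ltW.
have cF x : ballM M c delta0 x -> {for x, continuous (driftF Js r)}.
  move=> xin.
  suff : forall s : seq 'rV[int]_n.+1, {subset s <= Js} ->
      {for x, continuous (fun y => \sum_(J <- s) r J y *: intr_vec R J)}.
    by apply.
  elim=> [|J s IHs] sJs.
    have -> : (fun y => \sum_(J <- [::]) r J y *: intr_vec R J) = cst 0.
      by apply/funext => y; rewrite big_nil.
    exact: cst_continuous.
  have -> : (fun y => \sum_(K <- J :: s) r K y *: intr_vec R K) =
      (fun y => r J y *: intr_vec R J + \sum_(K <- s) r K y *: intr_vec R K).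
    by apply/funext => y; rewrite big_cons.
  have H1 : (fun y => r J y *: intr_vec R J) @ nbhs x --> r J x *: intr_vec R J.
    apply: cvgZ; last exact: cvg_cst.
    by apply: differentiable_continuous; apply: dr => //; apply: sJs; rewrite mem_head.
  have H2 := IHs (fun K Ks => sJs K (mem_behead (s := J :: s) Ks)).
  exact: (cvgD H1 H2).
have eig' l : is_eigenvalue (gradmat Js r c)^T l -> complex.Re l < 0.
  rewrite /is_eigenvalue char_poly_tr => /eig /lt_trans; apply.
  by rewrite oppr_lt0.
have [P [Psym Ppd Pneg]] := lyapunov_matrix eig'.
have near_c := inward_near_stable_point (fun J JJs => dr J c JJs c_in) Fc0 Pneg.
have [e e0 Pe] := nbhs_ballM Ppd (filterI near_c (ballM_nbhs M c delta0_gt0)).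
have local x : ballM P c e x ->
    bil M (driftF Js r x) (x - c) <= - rho * bil M (x - c) (x - c).
  apply: (@contraction_on_invariant_ball _ _ P c e Psym Ppd e0 (driftF Js r) _ M rho Msym Mpd delta0) => //.
  - by move=> y /Pe[_ /cF].
  - by move=> y /Pe[].
  - by move=> y /Pe[].
have [s0 s0_gt0 sub] := nbhs_ballM Mpd (ballM_nbhs P c e0).
apply: (@contraction_on_ball _ _ M c rho delta0 Msym Mpd rho0 delta0_gt0 _ cF contr s0 s0_gt0).
by move=> x /sub/local.
Qed.
(** * Tail of the stationary distribution *)

Section StationaryTail.
Context {R : realType}.

Lemma stationary_generator (T : eqType) (s : seq T) (pi f : T -> R) (q : T -> T -> R) :
  (forall Y, Y \in s ->
     \sum_(X <- s) pi X * q X Y = pi Y * \sum_(Y' <- s) q Y Y') ->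
  \sum_(X <- s) pi X * (\sum_(Y <- s) q X Y * (f Y - f X)) = 0.
Proof.
move=> bal.
have -> : \sum_(X <- s) pi X * (\sum_(Y <- s) q X Y * (f Y - f X)) =
    \sum_(X <- s) \sum_(Y <- s) pi X * q X Y * f Y -
    \sum_(X <- s) (pi X * \sum_(Y <- s) q X Y) * f X.
  rewrite -sumrB; apply: eq_bigr => X _.
  rewrite -mulrA mulr_suml !mulr_sumr -sumrB.
  by apply: eq_bigr => Y _; ring.
rewrite exchange_big/= -sumrB big_seq big1// => Y Ys.
by rewrite -bal// -mulr_suml subrr.
Qed.

Lemma stationary_tail (T : eqType) (s : seq T) (pi f : T -> R) (q : T -> T -> R)
    (tail : pred T) (K k : R) :
  (forall X, X \in s -> 0 <= pi X) -> \sum_(X <- s) pi X = 1 ->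
  (forall Y, Y \in s ->
     \sum_(X <- s) pi X * q X Y = pi Y * \sum_(Y' <- s) q Y Y') ->
  0 <= K ->
  (forall X, X \in s -> \sum_(Y <- s) q X Y * (f Y - f X) <= K) ->
  (forall X, X \in s -> tail X -> \sum_(Y <- s) q X Y * (f Y - f X) <= - k) ->
  k * \sum_(X <- s | tail X) pi X <= K.
Proof.
move=> pi0 pi1 bal K0 HK Hk.
rewrite -subr_ge0 -[leLHS](stationary_generator f bal) (bigID tail)/=.
apply: (@le_trans _ _ (\sum_(X <- s | tail X) pi X * - k + \sum_(X <- s | ~~ tail X) pi X * K)).
  apply: lerD; rewrite big_seq_cond [leRHS]big_seq_cond; apply: ler_sum => X /andP[Xs tX].
    by rewrite ler_wpM2l ?pi0 ?Hk.
  by rewrite ler_wpM2l ?pi0 ?HK.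
rewrite -!mulr_suml mulrN addrC; set a := \sum_(X <- s | tail X) pi X.
rewrite [a * k]mulrC lerD2r mulrC.
rewrite -[leRHS]mulr1 ler_wpM2l// -pi1 [leRHS](bigID tail)/= lerDr.
by rewrite big_seq_cond sumr_ge0// => X /andP[/pi0].
Qed.

Lemma expR_le_quadratic (x : R) : x <= 3 / 7 -> expR x <= 1 + x + 7 / 4 * x ^+ 2.
Proof.
move=> x37; have x1 : 0 < 1 - x by lra.
have := expR_ge1Dx (- x); rewrite expRN => H.
apply: (@le_trans _ _ (1 - x)^-1).
  by rewrite -[leLHS]invrK lef_pV2 ?posrE ?invr_gt0 ?expR_gt0.
rewrite -[leLHS]mul1r ler_pdivrMr//.
have -> : (1 + x + 7 / 4 * x ^+ 2) * (1 - x) = 1 + x ^+ 2 * (3 / 4 - 7 / 4 * x) by field.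
by rewrite lerDl mulr_ge0 ?sqr_ge0//; lra.
Qed.

Context {d : nat} (M : 'M[R]_d) (Msym : M^T = M) (Mpd : posdef M).

Definition regular_norm (m : R) (x : 'rV[R]_d) : R := Num.sqrt (bil M x x + m ^+ 2).

Lemma regular_norm_gt0 m x : 0 < m -> 0 < regular_norm m x.
Proof.
by move=> m0; rewrite sqrtr_gt0 ltr_wpDl ?bil_ge0// exprn_gt0.
Qed.

Lemma sqr_regular_norm m x : regular_norm m x ^+ 2 = mnorm M x ^+ 2 + m ^+ 2.
Proof.
by rewrite sqr_sqrtr ?sqr_mnorm// addr_ge0 ?sqr_ge0 ?bil_ge0.
Qed.

Definition jump_increment (sigma m : R) (x J : 'rV[R]_d) : R :=
  sigma * (2 * bil M J x + bil M J J) / (2 * regular_norm m x).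

(* Concavity of the square root. *)
Lemma regular_norm_jump sigma m x J : 0 < m -> 0 <= sigma ->
  sigma * regular_norm m (x + J) <=
    sigma * regular_norm m x + jump_increment sigma m x J.
Proof.
move=> m0 s0; set h := regular_norm m x; set h' := regular_norm m (x + J).
have h0 : 0 < h by exact: regular_norm_gt0.
have E : h' ^+ 2 = h ^+ 2 + (2 * bil M J x + bil M J J).
  rewrite /h /h' !sqr_regular_norm !sqr_mnorm// !(bilDl, bilDr) (bilC x J)//; ring.
rewrite /jump_increment -/h -mulrA -mulrDr ler_wpM2l//.
have -> : h + (2 * bil M J x + bil M J J) / (2 * h) = (h ^+ 2 + h' ^+ 2) / (2 * h).
  by rewrite E; field; rewrite gt_eqF.
rewrite ler_pdivlMr ?mulr_gt0//.
by have := sqr_ge0 (h - h'); rewrite sqrrB; lra.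
Qed.

Lemma jump_increment_bound sigma m x J p :
  0 < m -> 0 <= sigma -> 0 <= p -> 4 * p <= m -> mnorm M J <= p ->
  `|jump_increment sigma m x J| <= 9 / 8 * (sigma * p).
Proof.
move=> m0 s0 p0 pm Jp.
have h0 : 0 < regular_norm m x by exact: regular_norm_gt0.
have h2 : 0 < 2 * regular_norm m x by rewrite mulr_gt0.
rewrite /jump_increment !normrM (ger0_norm s0) normfV (gtr0_norm h2).
rewrite ler_pdivrMr//.
have -> : 9 / 8 * (sigma * p) * (2 * regular_norm m x) =
  sigma * (2 * (p * regular_norm m x) + p * (regular_norm m x / 4)) by field.
rewrite ler_wpM2l// (le_trans (ler_normD _ _))//.
have xh : mnorm M x <= regular_norm m x.
  rewrite -(ler_pXn2r (n := 2)) ?nnegrE ?mnorm_ge0 ?(ltW h0)// sqr_regular_norm.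
  by rewrite lerDl sqr_ge0.
have mh : m <= regular_norm m x.
  rewrite -(ler_pXn2r (n := 2)) ?nnegrE ?(ltW m0) ?(ltW h0)// sqr_regular_norm.
  by rewrite lerDr sqr_ge0.
apply: lerD.
  rewrite normrM ger0_norm// ler_pM2l//.
  apply: le_trans (normr_bil_le _ _ Msym Mpd) _.
  by rewrite ler_pM ?mnorm_ge0.
rewrite ger0_norm ?bil_ge0// -sqr_mnorm// expr2.
rewrite ler_pM ?mnorm_ge0// ler_pdivlMr// mulrC.
by apply: le_trans mh; apply: le_trans pm; rewrite ler_pM2l.
Qed.

Context (Js : seq 'rV[int]_d) (r : 'rV[int]_d -> 'rV[R]_d -> R) (c : 'rV[R]_d).
Context (N : nat) (N0 : (0 < N)%N) (s : seq 'rV[int]_d) (s_uniq : uniq s).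
Context (rho Z p Rs : R) (rho0 : 0 < rho) (p0 : 0 < p) (Rs0 : 0 < Rs).

Let scaled (X : 'rV[int]_d) : 'rV[R]_d := N%:R^-1 *: intr_vec R X.
Let xi (X : 'rV[int]_d) : 'rV[R]_d := intr_vec R X - N%:R *: c.

Context (contraction : forall X, X \in s ->
  bil M (driftF Js r (scaled X)) (scaled X - c) <=
    - rho * bil M (scaled X - c) (scaled X - c)).
Context (r_ge0 : forall X J, X \in s -> J \in Js -> 0 <= r J (scaled X)).
Context (r_le : forall X, X \in s -> \sum_(J <- Js) r J (scaled X) <= Rs).
Context (exit_outward : forall X J, X \in s -> J \in Js -> X + J \notin s ->
  0 < r J (scaled X) -> mnorm M (xi X) <= mnorm M (xi (X + J))).
Context (Jp : forall J, J \in Js -> mnorm M (intr_vec R J) <= p).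
Context (Zp : 8 * p <= Z) (ZR : 64 * (N%:R * Rs * p ^+ 2) <= rho * Z ^+ 2).

Let B := N%:R * Rs * p ^+ 2.
Let sigma := Num.min (3 / (8 * p)) (3 * rho * Z / (64 * B)).
Let f X := expR (sigma * regular_norm (Z / 2) (xi X)).
Let D X J := jump_increment sigma (Z / 2) (xi X) (intr_vec R J).

Let NR0 : 0 < N%:R :> R. Proof. by rewrite ltr0n. Qed.
Let B0 : 0 < B. Proof. by rewrite !mulr_gt0// exprn_gt0. Qed.
Let Z0 : 0 < Z. Proof. by apply: lt_le_trans Zp; rewrite mulr_gt0. Qed.
Let sigma0 : 0 < sigma.
Proof. by rewrite lt_min !divr_gt0 ?mulr_gt0. Qed.
Let sigma_p : sigma * p <= 3 / 8.
Proof.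
apply: (@le_trans _ _ (3 / (8 * p) * p)).
  by rewrite ler_wpM2r ?(ltW p0)// ge_min lexx.
by rewrite le_eqVlt; apply/orP; left; apply/eqP; field; rewrite gt_eqF.
Qed.
Let sigma_B : sigma * B <= 3 / 64 * (rho * Z).
Proof.
apply: (@le_trans _ _ (3 * rho * Z / (64 * B) * B)).
  by rewrite ler_wpM2r ?(ltW B0)// ge_min lexx orbT.
by rewrite le_eqVlt; apply/orP; left; apply/eqP; field; rewrite gt_eqF.
Qed.

Lemma xi_scaled X : xi X = N%:R *: (scaled X - c).
Proof. by rewrite scalerBr /scaled scalerA divff ?gt_eqF// scale1r. Qed.

Lemma xi_jump X J : xi (X + J) = xi X + intr_vec R J.
Proof. by rewrite /xi /intr_vec map_mxD addrAC. Qed.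

Lemma generator_jumps X (g : 'rV[int]_d -> R) :
  \sum_(Y <- s) rate Js r N X Y * (g Y - g X) =
  \sum_(J <- Js) N%:R * r J (scaled X) * (if X + J \in s then g (X + J) - g X else 0).
Proof.
under eq_bigr do rewrite /rate mulr_suml big_mkcond/=.
rewrite exchange_big/=; apply: eq_bigr => J _.
rewrite -big_mkcond/= -mulr_sumr; congr (_ * _).
case: ifPn => [XJs|XJs].
  rewrite -big_filter (_ : [seq _ <- _ | _] = [:: X + J]) ?big_seq1//.
  have /= <- := filter_pred1_uniq s_uniq XJs.
  by apply: eq_filter => Y /=; rewrite eq_sym.
rewrite big_seq_cond big_pred0// => Y; apply/negP => /andP[Ys /eqP XY].
by rewrite XY Ys in XJs.
Qed.

Lemma drift_le X : X \in s ->
  \sum_(Y <- s) rate Js r N X Y * (f Y - f X) <=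
    f X * \sum_(J <- Js) N%:R * r J (scaled X) * (D X J + 7 / 4 * D X J ^+ 2).
Proof.
move=> Xs; rewrite generator_jumps mulr_sumr big_seq [leRHS]big_seq.
apply: ler_sum => J JJs; rewrite mulrCA.
have rJ := r_ge0 Xs JJs.
have Z2 : 0 < Z / 2 by rewrite divr_gt0.
have fX : 0 < f X by exact: expR_gt0.
have [->|r_neq0] := eqVneq (r J (scaled X)) 0; first by rewrite mulr0 !mul0r.
have r0 : 0 < r J (scaled X) by rewrite lt_def r_neq0.
rewrite ler_pM2l ?mulr_gt0//.
case: ifPn => XJs.
  have Dle : D X J <= 3 / 7.
    apply: (le_trans (ler_norm _)); apply: le_trans (jump_increment_bound _ _ _ _ _ (Jp JJs)) _ => //.
    - exact: ltW.
    - exact: ltW.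
    - by rewrite ler_pdivlMr// mulrAC -natrM.
    - by have := sigma_p; lra.
  have E t : f X + f X * t = f X * (1 + t) by rewrite mulrDr mulr1.
  rewrite lerBlDl E /f xi_jump.
  apply: (@le_trans _ _ (expR (sigma * regular_norm (Z / 2) (xi X) + D X J))).
    by rewrite ler_expR; apply: regular_norm_jump => //; exact: ltW.
  rewrite expRD ler_pM2l ?expR_gt0// addrA; exact: expR_le_quadratic.
(* The jump is suppressed because it leaves the ball. *)
have D0 : 0 <= D X J.
  rewrite /D /jump_increment divr_ge0 ?mulr_ge0 ?(ltW sigma0)//; last exact/ltW/regular_norm_gt0.
  have := exit_outward Xs JJs XJs r0; rewrite xi_jump.
  move: (xi X) (intr_vec R J) => x y.
  rewrite -(ler_pXn2r (n := 2)) ?nnegrE ?mnorm_ge0// !sqr_mnorm//.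
  rewrite !(bilDl, bilDr) (bilC x y)//; lra.
by rewrite mulr_ge0 ?(ltW fX)// addr_ge0// mulr_ge0// sqr_ge0.
Qed.

Lemma jump_sum_le X : X \in s ->
  \sum_(J <- Js) N%:R * r J (scaled X) * (D X J + 7 / 4 * D X J ^+ 2) <=
    sigma * rho * Z / 8 -
    sigma * rho * (mnorm M (xi X) ^+ 2 / regular_norm (Z / 2) (xi X)).
Proof.
move=> Xs; set h := regular_norm _ _.
have Z2 : 0 < Z / 2 by rewrite divr_gt0.
have h0 : 0 < h by exact: regular_norm_gt0.
have hZ : Z / 2 <= h.
  rewrite -(ler_pXn2r (n := 2)) ?nnegrE ?(ltW Z2) ?(ltW h0)// sqr_regular_norm.
  by rewrite lerDr sqr_ge0.
have lin : \sum_(J <- Js) N%:R * r J (scaled X) * D X J <=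
    sigma / (2 * h) * (- 2 * rho * mnorm M (xi X) ^+ 2 + B).
  have -> : \sum_(J <- Js) N%:R * r J (scaled X) * D X J = sigma / (2 * h) *
      (2 * N%:R * bil M (driftF Js r (scaled X)) (xi X) +
       \sum_(J <- Js) N%:R * r J (scaled X) * bil M (intr_vec R J) (intr_vec R J)).
    rewrite /driftF bil_suml mulr_sumr -big_split mulr_sumr; apply: eq_bigr => J _.
    rewrite /D /jump_increment -/h bilZl /=; field.
    by rewrite gt_eqF.
  rewrite ler_wpM2l ?divr_ge0 ?mulr_ge0 ?(ltW h0) ?(ltW sigma0)//.
  apply: lerD.
    rewrite sqr_mnorm// xi_scaled bilZr bilZl bilZr.
    have := contraction Xs; set b := bil _ _ _; set b2 := bil _ _ _ => Hb.
    have -> : 2 * N%:R * (N%:R * b) = 2 * N%:R ^+ 2 * b by ring.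
    have -> : - 2 * rho * (N%:R * (N%:R * b2)) = 2 * N%:R ^+ 2 * (- rho * b2) by ring.
    by rewrite ler_wpM2l// mulr_ge0// sqr_ge0.
  apply: (@le_trans _ _ (\sum_(J <- Js) N%:R * r J (scaled X) * p ^+ 2)).
    rewrite big_seq [leRHS]big_seq; apply: ler_sum => J JJs.
    rewrite ler_wpM2l ?mulr_ge0 ?r_ge0// -sqr_mnorm//.
    by rewrite ler_pXn2r ?nnegrE ?mnorm_ge0 ?(ltW p0)// Jp.
  rewrite -mulr_suml -mulr_sumr /B ler_wpM2r ?sqr_ge0// ler_wpM2l//.
  exact: r_le.
have quad : \sum_(J <- Js) N%:R * r J (scaled X) * (7 / 4 * D X J ^+ 2) <=
    7 / 4 * (9 / 8) ^+ 2 * (sigma ^+ 2 * B).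
  pose w := 7 / 4 * (9 / 8 * (sigma * p)) ^+ 2.
  have w0 : 0 <= w by rewrite /w mulr_ge0// sqr_ge0.
  apply: (@le_trans _ _ (\sum_(J <- Js) N%:R * r J (scaled X) * w)).
    rewrite big_seq [leRHS]big_seq; apply: ler_sum => J JJs.
    rewrite ler_wpM2l ?mulr_ge0 ?r_ge0// /w.
    rewrite ler_pM2l// -real_normK ?num_real//.
    rewrite ler_pXn2r ?nnegrE//; last by rewrite !mulr_ge0// ltW.
    apply: jump_increment_bound => //; try exact: ltW.
    - by rewrite ler_pdivlMr// mulrAC -natrM.
    - exact: Jp.
  rewrite -mulr_suml -mulr_sumr.
  have -> : 7 / 4 * (9 / 8) ^+ 2 * (sigma ^+ 2 * B) = N%:R * Rs * w.
    by rewrite /B /w; ring.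
  apply: ler_wpM2r => //; apply: ler_wpM2l => //.
  exact: r_le.
under eq_bigr do rewrite mulrDr.
rewrite big_split/=; apply: le_trans (lerD lin quad) _.
have -> : sigma / (2 * h) * (- 2 * rho * mnorm M (xi X) ^+ 2 + B) =
    sigma * B / (2 * h) - sigma * rho * (mnorm M (xi X) ^+ 2 / h).
  by field; rewrite gt_eqF.
rewrite addrAC lerD2r.
have t1 : sigma * B / (2 * h) <= sigma * (rho * Z / 64).
  rewrite -[leLHS]mulrA; apply: ler_wpM2l; first exact: ltW.
  rewrite ler_pdivrMr ?mulr_gt0//.
  apply: (@le_trans _ _ (rho * Z / 64 * Z)).
    have -> : rho * Z / 64 * Z = rho * Z ^+ 2 / 64 by field.
    by rewrite ler_pdivlMr// mulrC; exact: ZR.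
  apply: ler_wpM2l; first by rewrite divr_ge0// mulr_ge0// ltW.
  by move: hZ; lra.
have t2 : 7 / 4 * (9 / 8) ^+ 2 * (sigma ^+ 2 * B) <=
    7 / 4 * (9 / 8) ^+ 2 * (sigma * (3 / 64 * (rho * Z))).
  apply: ler_wpM2l; first by rewrite mulr_ge0// sqr_ge0.
  by rewrite expr2 -[leLHS]mulrA; apply: ler_wpM2l => //; exact: ltW.
apply: le_trans (lerD t1 t2) _.
have : 0 <= sigma * (rho * Z) by rewrite !mulr_ge0 ?ltW.
have -> : sigma * (rho * Z / 64) = sigma * (rho * Z) / 64 by ring.
have -> : sigma * (3 / 64 * (rho * Z)) = 3 / 64 * (sigma * (rho * Z)) by ring.
have -> : sigma * rho * Z / 8 = sigma * (rho * Z) / 8 by ring.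
rewrite expr2; lra.
Qed.

Lemma stationary_tail_expR (pi : 'rV[int]_d -> R) :
  (forall X, X \in s -> 0 <= pi X) -> \sum_(X <- s) pi X = 1 ->
  (forall Y, Y \in s ->
     \sum_(X <- s) pi X * rate Js r N X Y =
     pi Y * \sum_(Y' <- s) rate Js r N Y Y') ->
  \sum_(X <- s | Z < mnorm M (xi X)) pi X <= expR (- (7 / 20 * (sigma * Z))).
Proof.
move=> pi0 pi1 bal.
have w0 : 0 < sigma * rho * Z / 8 by rewrite divr_gt0// !mulr_gt0.
have Z2 : 0 < Z / 2 by rewrite divr_gt0.
have fle X : X \in s -> \sum_(Y <- s) rate Js r N X Y * (f Y - f X) <=
    f X * (sigma * rho * Z / 8 -
      sigma * rho * (mnorm M (xi X) ^+ 2 / regular_norm (Z / 2) (xi X))).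
  move=> Xs; apply: le_trans (drift_le Xs) _.
  by apply: ler_wpM2l; [exact/ltW/expR_gt0|exact: jump_sum_le].
have outer X : Z / 2 <= mnorm M (xi X) -> sigma * rho * Z / 8 -
    sigma * rho * (mnorm M (xi X) ^+ 2 / regular_norm (Z / 2) (xi X)) <=
    - (sigma * rho * Z / 8).
  move=> ZX; set h := regular_norm _ _.
  have h0 : 0 < h by exact: regular_norm_gt0.
  have hZ : Z / 2 <= h.
    rewrite -(ler_pXn2r (n := 2)) ?nnegrE ?(ltW Z2) ?(ltW h0)// sqr_regular_norm.
    by rewrite lerDr sqr_ge0.
  have ge : Z / 4 <= mnorm M (xi X) ^+ 2 / h.
    rewrite ler_pdivlMr//; apply: (@le_trans _ _ (h ^+ 2 / 2)).
      by have := ler_wpM2l (ltW h0) hZ; rewrite expr2; lra.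
    rewrite sqr_regular_norm.
    have : (Z / 2) ^+ 2 <= mnorm M (xi X) ^+ 2.
      by rewrite ler_pXn2r ?nnegrE ?mnorm_ge0 ?(ltW Z2).
    lra.
  have sr0 : 0 < sigma * rho by rewrite mulr_gt0.
  have := ler_wpM2l (ltW sr0) ge.
  have -> : sigma * rho * (Z / 4) = sigma * rho * Z / 4 by ring.
  lra.
pose K := sigma * rho * Z / 8 * expR (sigma * (3 / 4 * Z)).
pose k := sigma * rho * Z / 8 * expR (sigma * (11 / 10 * Z)).
have tail_le := @stationary_tail _ s pi f (rate Js r N)
  (fun X => Z < mnorm M (xi X)) K k pi0 pi1 bal.
have K0 : 0 < K by rewrite mulr_gt0// expR_gt0.
have k0 : 0 < k by rewrite mulr_gt0// expR_gt0.
have {tail_le} : k * \sum_(X <- s | Z < mnorm M (xi X)) pi X <= K.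
  apply: tail_le; first exact: ltW.
    move=> X Xs; apply: le_trans (fle X Xs) _.
    have [XZ|ZX] := ltP (mnorm M (xi X)) (Z / 2); last first.
      apply: (@le_trans _ _ 0); last exact: ltW.
      rewrite pmulr_rle0 ?expR_gt0//; apply: le_trans (outer X ZX) _.
      by rewrite oppr_le0 ltW.
    apply: (@le_trans _ _ (f X * (sigma * rho * Z / 8))).
      apply: ler_wpM2l; first exact/ltW/expR_gt0.
      have h0 : 0 <= regular_norm (Z / 2) (xi X) by exact: sqrtr_ge0.
      have sr0 : 0 <= sigma * rho by rewrite mulr_ge0// ltW.
      by rewrite gerBl; apply: mulr_ge0 => //; apply: divr_ge0 => //; exact: sqr_ge0.
    rewrite mulrC; apply: ler_wpM2l; first exact: ltW.
    rewrite ler_expR; apply: ler_wpM2l; first exact: ltW.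
    rewrite -(ler_pXn2r (n := 2)) ?nnegrE ?sqrtr_ge0//; last by rewrite mulr_ge0// ltW.
    rewrite sqr_regular_norm.
    have : mnorm M (xi X) ^+ 2 <= (Z / 2) ^+ 2.
      by rewrite ler_pXn2r ?nnegrE ?mnorm_ge0 ?(ltW Z2)// ltW.
    have := sqr_ge0 Z; rewrite !exprMn; lra.
  move=> X Xs ZX; apply: le_trans (fle X Xs) _.
  have ZX2 : Z / 2 <= mnorm M (xi X) by move: ZX Z0; lra.
  apply: (@le_trans _ _ (f X * - (sigma * rho * Z / 8))).
    by apply: ler_wpM2l; [exact/ltW/expR_gt0|exact: outer].
  rewrite mulrN lerN2 /k mulrC; apply: ler_wpM2r; first exact: ltW.
  rewrite ler_expR; apply: ler_wpM2l; first exact: ltW.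
  rewrite -(ler_pXn2r (n := 2)) ?nnegrE ?sqrtr_ge0//; last by rewrite mulr_ge0// ltW.
  rewrite sqr_regular_norm.
  have : Z ^+ 2 <= mnorm M (xi X) ^+ 2.
    by rewrite ler_pXn2r ?nnegrE ?mnorm_ge0 ?(ltW Z0)// ltW.
  have := sqr_ge0 Z; rewrite !exprMn; lra.
rewrite mulrC -ler_pdivlMr// => /le_trans; apply.
rewrite /K /k -mulf_div divff ?gt_eqF// mul1r -expRN -expRD ler_expR.
by rewrite le_eqVlt; apply/orP; left; apply/eqP; field.
Qed.

End StationaryTail.
(** * The constants of the bound *)

Section LargestEigenvalue.
Context {R : realType} {n : nat}.
Implicit Types (M : 'M[R]_n.+1) (x y : 'rV[R]_n.+1).

Lemma bil1E x y : bil 1%:M x y = \sum_i x 0 i * y 0 i.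
Proof. by rewrite /bil mulmx1 mxE; apply: eq_bigr => i _; rewrite mxE. Qed.

Lemma euclidE x : euclid x = mnorm 1%:M x.
Proof.
by rewrite mnormE bil1E /euclid; congr Num.sqrt; apply: eq_bigr => i _; rewrite expr2.
Qed.

Lemma posdef1 : posdef (1%:M : 'M[R]_n.+1).
Proof.
move=> x x0; rewrite bil1E lt_def; apply/andP; split; last first.
  by apply: sumr_ge0 => i _; rewrite -expr2 sqr_ge0.
apply: contra_neq x0 => sum0; apply/rowP => i; rewrite [RHS]mxE.
have /(_ i isT)/eqP : forall j, true -> x 0 j * x 0 j = 0.
  by apply: psumr_eq0P => // j _; rewrite -expr2 sqr_ge0.
by rewrite mulf_eq0 orbb => /eqP.
Qed.

Lemma psd_kernel (A : 'M[R]_n.+1) x : A^T = A -> (forall y, 0 <= bil A y y) ->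
  bil A x x = 0 -> x *m A = 0.
Proof.
move=> Asym Apsd x0.
have b0 y : bil A x y = 0.
  set b := bil A x y; set q := bil A y y.
  have q0 : 0 <= q by exact: Apsd.
  have q1 : 0 < q + 1 by rewrite ltr_wpDl.
  have := Apsd (x + (- b / (q + 1)) *: y).
  rewrite !(bilDl, bilDr, bilZl, bilZr) (bilC y x)// x0 -/b -/q.
  have -> : 0 + - b / (q + 1) * b + (- b / (q + 1) * b +
      - b / (q + 1) * (- b / (q + 1) * q)) = - (b ^+ 2 * ((q + 2) / (q + 1) ^+ 2)).
    by field; rewrite gt_eqF.
  rewrite oppr_ge0 pmulr_lle0; last by rewrite divr_gt0 ?exprn_gt0// ltr_wpDl.
  by move=> b2; apply/eqP; rewrite -sqrf_eq0 eq_le b2 sqr_ge0.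
apply/rowP => j; rewrite [RHS]mxE -(b0 (delta_mx 0 j)) /bil trmx_delta.
by rewrite -colE [RHS]mxE.
Qed.

Lemma bil_le_lam_max M x : M^T = M -> bil M x x <= lam_max M * euclid x ^+ 2.
Proof.
move=> Msym; have I_sym : (1%:M : 'M[R]_n.+1)^T = 1%:M by exact: trmx1.
pose K := [set y : 'rV[R]_n.+1 | bil 1%:M y y = 1].
have subid (A : 'M[R]_n.+1) : continuous (fun y => bil A y y).
  move=> y; exact: (bil_cvg (P := A) (@cvg_id _ (nbhs y)) (@cvg_id _ (nbhs y))).
have cK : compact K.
  apply: (subclosed_compact _ (ballM_compact (c := 0) (e := 1) posdef1)); last first.
    by move=> y Ky; rewrite /ballM/= subr0 mnormE Ky sqrtr1.
  apply: (@preimage_closed _ _ (fun y => bil 1%:M y y) [set t | t = 1]).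
    by move=> y _; exact: subid.
  exact: closed_eq.
have K0 : K !=set0.
  exists (delta_mx 0 0); rewrite /K/= bil1E (bigD1 0)//= big1 => [|i i0].
    by rewrite !mxE !eqxx mulr1 addr0.
  by rewrite !mxE (negbTE i0) mulr0.
have [m Km max] := EVT_max_rV K0 cK (continuous_subspaceT (subid M)).
rewrite inE in Km; set l := bil M m m.
have le_l y : bil M y y <= l * bil 1%:M y y.
  have [->|y0] := eqVneq y 0; first by rewrite !bil0l mulr0.
  have b0 := posdef1 y0; set a := bil 1%:M y y in b0 *.
  have := max ((Num.sqrt a)^-1 *: y); rewrite inE /K/= !bilZl !bilZr !mulrA -/a.
  rewrite -expr2 exprVn sqr_sqrtr ?(ltW b0)// mulVf ?gt_eqF// => /(_ erefl).
  by rewrite mulrC ler_pdivrMr.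
have mM : m *m M = l *: m.
  pose A := l%:M - M.
  have bilA y z : bil A y z = l * bil 1%:M y z - bil M y z.
    by rewrite /bil /A mulmxBr mulmxBl mxE [X in _ + X]mxE mulmx1 mul_mx_scalar -scalemxAl mxE.
  have := @psd_kernel A m; rewrite bilA Km mulr1 subrr.
  have -> : A^T = A by rewrite /A linearB/= tr_scalar_mx Msym.
  move=> /(_ erefl _ erefl); rewrite /A mulmxBr mul_mx_scalar => H.
  apply/eqP; rewrite eq_sym -subr_eq0; apply/eqP; apply: H => y.
  by rewrite bilA subr_ge0.
have rootE a : root (char_poly M) a -> a <= l.
  rewrite -eigenvalue_root_char => /eigenvalueP[v vM v0].
  have := le_l v; rewrite {1}/bil vM -/(bil _ _ _).
  have -> : (a *: v *m v^T) 0 0 = a * bil 1%:M v v.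
    by rewrite /bil mulmx1 -scalemxAl mxE.
  by rewrite ler_pM2r// posdef1.
have l_le : l <= lam_max M.
  apply: ub_le_sup; first by exists l => a; exact: rootE.
  rewrite /= -eigenvalue_root_char; apply/eigenvalueP; exists m => //.
  apply/eqP => m0; move: Km; rewrite /K/= m0 bil0l => /eqP.
  by rewrite eq_sym oner_eq0.
apply: le_trans (le_l x) _; rewrite euclidE sqr_mnorm; last exact: posdef1.
by rewrite ler_wpM2r// bil_ge0//; exact: posdef1.
Qed.

Lemma mnorm_le_c1 M x : M^T = M -> posdef M -> mnorm M x <= c1 M * euclid x.
Proof.
move=> Msym Mpd; have e0 : 0 <= euclid x by exact: sqrtr_ge0.
rewrite mnorm_le; last by rewrite mulr_ge0// sqrtr_ge0.
apply: le_trans (bil_le_lam_max x Msym) _; rewrite exprMn.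
rewrite ler_wpM2r ?sqr_ge0// /c1.
have [l0|l0] := leP 0 (lam_max M); first by rewrite sqr_sqrtr.
by rewrite (le_trans (ltW l0)) ?sqr_ge0.
Qed.

Lemma c1_gt0 M : M^T = M -> posdef M -> 0 < c1 M.
Proof.
move=> Msym Mpd; rewrite lt_def sqrtr_ge0 andbT; apply/eqP => c0.
have x0 : (delta_mx 0 0 : 'rV[R]_n.+1) != 0.
  apply/eqP => /rowP/(_ 0); rewrite !mxE !eqxx => /eqP; rewrite oner_eq0//.
have := mnorm_le_c1 (delta_mx 0 0) Msym Mpd.
by rewrite c0 mul0r leNgt mnorm_gt0.
Qed.

End LargestEigenvalue.

Section Constants.
Context {R : realType} {n : nat}.
Implicit Types (Js : seq 'rV[int]_n.+1) (r : 'rV[int]_n.+1 -> 'rV[R]_n.+1 -> R).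

Lemma sup_nonneg (A : set R) : (forall x, A x -> 0 <= x) -> 0 <= sup A.
Proof.
move=> A0; have [supA|] := pselect (has_sup A); last by move/sup_out ->.
by have [[x Ax] ubA] := supA; apply: le_trans (A0 _ Ax) (ub_le_sup ubA Ax).
Qed.

Lemma Lconst_ge0 Js r K : 0 <= Lconst Js r K.
Proof.
apply: sup_nonneg => _ [y _ <-]; apply: sup_nonneg => _ [v _ <-].
exact: sqrtr_ge0.
Qed.

Lemma euclid_le_Jstar Js J : J \in Js -> euclid (intr_vec R J) <= Jstar R Js.
Proof. by move=> JJs; rewrite /Jstar; exact: (le_bigmax_seq 0 J xpredT (fun K => euclid (intr_vec R K)) JJs isT). Qed.

Lemma Jstar_gt0 Js :
  (forall v : 'rV[int]_n.+1, exists s : seq 'rV[int]_n.+1,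
     (forall J, J \in s -> J \in Js) /\ v = \sum_(J <- s) J) ->
  0 < Jstar R Js.
Proof.
move=> gen; have [s [sJs sE]] := gen (delta_mx 0 0).
have [J Js_J J0] : exists2 J, J \in Js & J != 0.
  apply: contrapT => H.
  have : (delta_mx 0 0 : 'rV[int]_n.+1) = 0.
    rewrite sE big_seq big1// => J Jins; apply/eqP/negPn/negP => J0.
    by apply: H; exists J => //; exact: sJs.
  by move=> /rowP/(_ 0); rewrite !mxE.
apply: lt_le_trans (euclid_le_Jstar Js_J).
rewrite euclidE; apply: mnorm_gt0; first exact: posdef1.
apply: contra_neq J0 => /rowP E; apply/rowP => i.
by have := E i; rewrite !mxE => /eqP; rewrite intr_eq0 => /eqP.
Qed.

Lemma rates_le_Rstar Js r M c (delta0 : R) : posdef M ->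
  (forall J y, J \in Js -> ballM M c delta0 y -> differentiable (r J) y) ->
  forall y, ballM M c delta0 y ->
    \sum_(J <- Js) r J y <= Rstar Js r (ballM M c delta0).
Proof.
move=> Mpd dr y yin; apply: ub_le_sup; last by exists y.
have cr : {within ballM M c delta0, continuous (fun y => \sum_(J <- Js) r J y)}.
  apply: continuous_in_subspaceT => x; rewrite inE => xin.
  elim: Js dr => [|J Js IHs] dr.
    have -> : (fun y => \sum_(J <- [::]) r J y) = cst 0.
      by apply/funext => z; rewrite big_nil.
    exact: cst_continuous.
  have -> : (fun y => \sum_(K <- J :: Js) r K y) =
      (fun y => r J y + \sum_(K <- Js) r K y).
    by apply/funext => z; rewrite big_cons.
  have H1 : {for x, continuous (r J)}.
    by apply: differentiable_continuous; apply: dr => //; rewrite mem_head.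
  have H2 := IHs (fun K z KJs => dr K z (mem_behead (s := J :: Js) KJs)).
  exact: (cvgD H1 H2).
have [m _ max] := EVT_max_rV (ex_intro _ y yin) (ballM_compact Mpd) cr.
exists (\sum_(J <- Js) r J m) => _ [x xin <-].
by apply: max; rewrite inE.
Qed.

Lemma Xset_finite (S : nat -> set 'rV[int]_n.+1) (M : 'M[R]_n.+1) c N (delta : R) :
  posdef M -> finite_set (Xset S M c N delta).
Proof.
move=> Mpd.
have [B [_ HB]] := compact_bounded (ballM_compact (c := N%:R *: c) (e := N%:R * delta) Mpd).
have B1 : B < `|B| + 1 by rewrite ltr_pwDr ?ler_norm.
pose k := Num.truncn (`|B| + 1).
pose g (Y : 'rV['I_(k + k).+1]_n.+1) : 'rV[int]_n.+1 := map_mx (fun j : 'I_(k + k).+1 => (j : nat)%:Z - k%:Z) Y.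
apply: (@sub_finite_set _ _ (range g)); last exact/finite_image/finite_finset.
move=> X [_ XN].
have bound i : `|X 0 i| <= k%:Z.
  have : `|intr_vec R X| <= `|B| + 1 by exact: (HB _ B1).
  move=> /(le_trans (norm_coord_le _ i)); rewrite mxE -intr_norm.
  rewrite -[`|X 0 i|]gez0_abs// => H; rewrite lez_nat /k.
  by rewrite truncn_ge_nat ?addr_ge0.
exists (\row_i inord (absz (X 0 i + k%:Z))) => //.
apply/rowP => i; rewrite !mxE.
have := bound i; rewrite ler_norml => /andP[lo hi].
have p0 : 0 <= X 0 i + k%:Z by rewrite -lerBlDr sub0r.
rewrite inordK; first by rewrite gez0_abs// addrK.
by rewrite ltnS -lez_nat gez0_abs// PoszD lerD2r.
Qed.

End Constants.
Lemma zeta_exponent_le (R : realType) (N d : nat) (w z k J Rs rho : R) :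
  (0 < N)%N -> (0 < d)%N -> 0 <= w -> w <= z / (4 * k) ->
  0 < k -> 0 < J -> 0 < Rs -> 0 < rho ->
  let E := (N%:R * w) / (2 * d%:R * J) *
    Num.min 1 (w / (d%:R * expR 1 * rho^-1 * Rs * J)) in
  E <= N%:R * z / (8 * (k * J)) /\
  E <= rho * (N%:R * z) ^+ 2 / (64 * (N%:R * Rs * (k * J) ^+ 2)).
Proof.
move=> N0 d0 w0 wz k0 J0 Rs0 rho0 E.
have NR0 : 0 < N%:R :> R by rewrite ltr0n.
have d1 : 1 <= d%:R :> R by rewrite ler1n.
have dR0 : 0 < d%:R :> R by rewrite ltr0n.
have e2 : 2 <= expR 1 :> R by have := expR_ge1Dx (1 : R); lra.
pose A := (N%:R * w) / (2 * d%:R * J).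
have A0 : 0 <= A by rewrite divr_ge0 ?mulr_ge0// ltW.
pose q := w / (d%:R * expR 1 * rho^-1 * Rs * J).
have den0 : 0 < d%:R * expR 1 * rho^-1 * Rs * J.
  by rewrite !mulr_gt0 ?invr_gt0 ?expR_gt0.
have q0 : 0 <= q by rewrite divr_ge0// ltW.
have A_le : A <= N%:R * z / (8 * (k * J)).
  have -> : N%:R * z / (8 * (k * J)) = N%:R * (z / (4 * k)) / (2 * 1 * J).
    by field; rewrite ?gt_eqF.
  apply: ler_pM; rewrite ?invr_ge0 ?mulr_ge0 ?(ltW J0)//.
    by apply: ler_wpM2l => //; exact: ltW.
  rewrite lef_pV2 ?posrE ?mulr_gt0//.
  by apply: ler_wpM2r; [exact: ltW|apply: ler_wpM2l].
have q_le : q <= z / (4 * k) * (rho / (2 * Rs * J)).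
  apply: ler_pM; rewrite ?invr_ge0 ?(ltW den0)//.
  have -> : rho / (2 * Rs * J) = (1 * 2 * rho^-1 * Rs * J)^-1.
    by field; rewrite ?gt_eqF.
  rewrite lef_pV2 ?posrE ?mulr_gt0 ?invr_gt0//.
  apply: ler_wpM2r; first exact: ltW.
  apply: ler_wpM2r; first exact: ltW.
  apply: ler_wpM2r; first by rewrite invr_ge0 ltW.
  by apply: ler_pM.
split.
  apply: le_trans A_le; rewrite /E -/A -[leRHS]mulr1; apply: ler_wpM2l => //.
  by rewrite ge_min lexx.
apply: (@le_trans _ _ (A * q)).
  by rewrite /E -/A; apply: ler_wpM2l => //; rewrite ge_min lexx orbT.
apply: (le_trans (ler_pM A0 q0 A_le q_le)).
by rewrite le_eqVlt; apply/orP; left; apply/eqP; field; rewrite ?gt_eqF.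
Qed.


Lemma expRN1_ge (R : realType) : 1 / 4 <= expR (- 1) :> R.
Proof.
have h : 1 / 2 <= expR (- (1 / 2)) :> R by have := expR_ge1Dx (- (1 / 2) : R); lra.
have -> : -1 = - (1 / 2) - 1 / 2 :> R by field.
rewrite expRD; have -> : 1 / 4 = 1 / 2 * (1 / 2) :> R by field.
by apply: ler_pM.
Qed.

Lemma stationary_concentration (R : realType) (n : nat)
    (S : nat -> set 'rV[int]_n.+1) (Shat : set 'rV[R]_n.+1)
    (Js : seq 'rV[int]_n.+1) (r : 'rV[int]_n.+1 -> 'rV[R]_n.+1 -> R)
    (c : 'rV[R]_n.+1) (rho : R) (M : 'M[R]_n.+1) (delta0 : R) :
  (forall J y, J \in Js -> Shat y -> 0 <= r J y) ->
  (forall J y, J \in Js -> Shat y -> differentiable (r J) y) ->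
  (forall N X J, (0 < N)%N -> S N X -> J \in Js ->
     0 < r J ((N%:R)^-1 *: intr_vec R X) -> S N (X + J)) ->
  (forall v : 'rV[int]_n.+1, exists s : seq 'rV[int]_n.+1,
     (forall J, J \in s -> J \in Js) /\ v = \sum_(J <- s) J) ->
  driftF Js r c = 0 -> (forall J, J \in Js -> 0 < r J c) -> 0 < rho ->
  (forall l : R[i], is_eigenvalue (gradmat Js r c) l -> complex.Re l < - rho) ->
  M^T = M -> posdef M -> 0 < delta0 -> ballM M c delta0 `<=` Shat ->
  (forall y : R -> 'rV[R]_n.+1, is_ode_sol (driftF Js r) y ->
     mnorm M (y 0 - c) <= delta0 ->
     forall t, 0 < t -> contracts rho (fun s => mnorm M (y s - c)) t) ->
  forall (N : nat) (z delta : R), (0 < N)%N -> 0 < z -> z < delta -> delta <= delta0 ->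
  forall pi : 'rV[int]_n.+1 -> R,
  is_stationary (Xset S M c N delta) (rate Js r N) pi ->
  \sum_(X \in Xset S M c N delta `&`
          [set X | ~ ballM M (N%:R *: c) (N%:R * z) (intr_vec R X)]) pi X
    <= 2 * zetahat Js r M c rho delta0 N (z * (1 - expR (- (1/2))) / (2 * c1 M)).
Proof.
move=> r_ge0 dr jumps gen Fc0 rc rho0 eig Msym Mpd delta0_gt0 ball_sub contr.
move=> N z delta N0 z0 zdelta delta_le pi [pi_ge0 pi_sum bal].
have dr' J y : J \in Js -> ballM M c delta0 y -> differentiable (r J) y.
  by move=> JJs /ball_sub; exact: dr.
have contraction := drift_contraction dr' Fc0 rho0 eig Msym Mpd delta0_gt0 contr.
have fin : finite_set (Xset S M c N delta) by exact: Xset_finite.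
have NR0 : 0 < N%:R :> R by rewrite ltr0n.
pose s : seq 'rV[int]_n.+1 := finmap.enum_fset (fset_set (Xset S M c N delta)).
have s_mem X : (X \in s) <-> Xset S M c N delta X.
  have -> : (X \in s) = (X \in Xset S M c N delta) by exact: (in_fset_set fin X).
  by rewrite in_setE.
have s_ball X : X \in s -> ballM M c delta0 (N%:R^-1 *: intr_vec R X).
  move=> /s_mem[_ XN]; rewrite /ballM/=.
  have -> : N%:R^-1 *: intr_vec R X - c = N%:R^-1 *: (intr_vec R X - N%:R *: c).
    by rewrite scalerBr scalerA mulVf ?gt_eqF// scale1r.
  rewrite mnormZ ?invr_ge0 ?(ltW NR0)// mulrC ler_pdivrMr// mulrC.
  by apply: le_trans XN _; rewrite ler_pM2l.
have sumE (f : 'rV[int]_n.+1 -> R) :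
    \sum_(X \in Xset S M c N delta) f X = \sum_(X <- s) f X by rewrite fsbig_finite.
have pi1 : \sum_(X <- s) pi X = 1 by rewrite -sumE.
have pi0 X : X \in s -> 0 <= pi X by move=> /s_mem/pi_ge0.
have bal' Y : Y \in s -> \sum_(X <- s) pi X * rate Js r N X Y =
    pi Y * \sum_(Y' <- s) rate Js r N Y Y'.
  by move=> /s_mem/bal; rewrite !sumE.
rewrite fsbig_mkcondr sumE.
have -> : \sum_(X <- s) (if X \in [set X | ~ ballM M (N%:R *: c) (N%:R * z) (intr_vec R X)]
      then pi X else 0) =
    \sum_(X <- s | N%:R * z < mnorm M (intr_vec R X - N%:R *: c)) pi X.
  rewrite [RHS]big_mkcond; apply: eq_bigr => X _; congr (if _ then _ else _).
  apply/idP/idP; rewrite in_setE /ballM/= ltNge; first by move/negP.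
  by move=> ?; apply/negP.
set tail := \sum_(X <- s | _) _.
have tail1 : tail <= 1.
  rewrite -pi1 [leRHS](bigID (fun X => N%:R * z < mnorm M (intr_vec R X - N%:R *: c)))/=.
  rewrite lerDl big_seq_cond sumr_ge0// => X /andP[Xs _]; exact: pi0.
pose k := c1 M; pose J := Jstar R Js; pose Rs := Rstar Js r (ballM M c delta0).
have k0 : 0 < k by exact: c1_gt0.
have J0 : 0 < J by exact: Jstar_gt0.
have c_in : ballM M c delta0 c by rewrite /ballM/= subrr mnorm0 ltW.
have Rs0 : 0 < Rs.
  apply: lt_le_trans (rates_le_Rstar Mpd dr' c_in).
  have Js_nil : Js != [::].
    by apply: contraTneq J0 => Js0; rewrite /J /Jstar Js0 big_nil ltxx.
  have [J1 J1s] : exists J1, J1 \in Js.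
    by case: (Js) Js_nil => // J1 Js1 _; exists J1; rewrite mem_head.
  rewrite (perm_big _ (perm_to_rem J1s))/= big_cons ltr_pwDl ?rc//.
  by rewrite big_seq sumr_ge0// => K /mem_rem KJs; exact/ltW/rc.
pose w := z * (1 - expR (- (1 / 2))) / (2 * c1 M) *
  expR (- (rho^-1 * Lconst Js r (ballM M c delta0))).
have half : 1 / 2 <= expR (- (1 / 2)) :> R by have := expR_ge1Dx (- (1 / 2) : R); lra.
have half1 : expR (- (1 / 2)) <= 1 :> R by rewrite -[leRHS]expR0 ler_expR; lra.
have v0 : 0 <= z * (1 - expR (- (1 / 2))) / (2 * k).
  by apply: divr_ge0; apply: mulr_ge0 => //; rewrite ?subr_ge0// ltW.
have w0 : 0 <= w by rewrite /w; apply: mulr_ge0 => //; exact: expR_ge0.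
have wz : w <= z / (4 * k).
  apply: (@le_trans _ _ (z * (1 - expR (- (1 / 2))) / (2 * k))).
    rewrite -[leRHS]mulr1 /w; apply: ler_wpM2l => //.
    rewrite -[leRHS]expR0 ler_expR oppr_le0 mulr_ge0 ?invr_ge0 ?(ltW rho0)//.
    exact: Lconst_ge0.
  have -> : z / (4 * k) = z * (1 / 2) / (2 * k) by field; rewrite gt_eqF.
  apply: ler_wpM2r; first by rewrite invr_ge0 mulr_ge0// ltW.
  by apply: ler_wpM2l; [exact: ltW|lra].
have [E1 E2] := zeta_exponent_le N0 (ltn0Sn n) w0 wz k0 J0 Rs0 rho0.
rewrite /zetahat /zeta -/w -/J -/Rs mulNr.
set E := _ * Num.min _ _ in E1 E2 *.
have d4 : 4 <= 2 * (2 * n.+1%:R) :> R.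
  have : 1 <= n.+1%:R :> R by rewrite ler1n.
  lra.
suff main : tail <= 4 * expR (- E).
  apply: le_trans main _; rewrite [leRHS]mulrA.
  by apply: ler_wpM2r => //; exact: expR_ge0.
have trivial_case : E <= 1 -> tail <= 4 * expR (- E).
  move=> El1; apply: le_trans tail1 _.
  apply: (@le_trans _ _ (4 * expR (- 1))); first by have := expRN1_ge R; lra.
  by apply: ler_wpM2l => //; rewrite ler_expR lerN2.
have p0 : 0 < k * J by rewrite mulr_gt0.
have B0 : 0 < N%:R * Rs * (k * J) ^+ 2 by rewrite !mulr_gt0// exprn_gt0.
have [Zp|Zp] := ltP (N%:R * z) (8 * (k * J)).
  apply: trivial_case; apply: le_trans E1 _.
  by rewrite ler_pdivrMr ?mulr_gt0// mul1r ltW.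
have [ZR|ZR] := ltP (rho * (N%:R * z) ^+ 2) (64 * (N%:R * Rs * (k * J) ^+ 2)).
  apply: trivial_case; apply: le_trans E2 _.
  by rewrite ler_pdivrMr ?mulr_gt0// mul1r ltW.
have Jp K : K \in Js -> mnorm M (intr_vec R K) <= k * J.
  move=> KJs; apply: le_trans (mnorm_le_c1 _ Msym Mpd) _.
  by rewrite ler_pM2l//; exact: euclid_le_Jstar.
have s_uniq : uniq s by exact: finmap.fset_uniq.
have bound := @stationary_tail_expR _ _ M Msym Mpd Js r c N N0 s s_uniq rho
  (N%:R * z) (k * J) Rs rho0 p0 Rs0 (fun X Xs => contraction _ (s_ball X Xs))
  (fun X K Xs KJs => r_ge0 K _ KJs (ball_sub _ (s_ball X Xs)))
  (fun X Xs => rates_le_Rstar Mpd dr' (s_ball X Xs)) _ Jp Zp ZR pi pi0 pi1 bal'.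
apply: (le_trans (bound _)).
  move=> X K Xs KJs XKs rK; have [SX XN] := (s_mem X).1 Xs.
  have SXK := jumps N X K N0 SX KJs rK.
  apply: le_trans XN _; rewrite leNgt; apply/negP => XKN.
  by move/negP: XKs; apply; apply/s_mem; split => //; exact: ltW.
apply: (@le_trans _ _ (expR (- E))); last first.
  by rewrite -[leLHS]mul1r ler_wpM2r ?expR_ge0//; lra.
rewrite ler_expR lerN2.
have Z0 : 0 < N%:R * z by rewrite mulr_gt0.
rewrite minEle; case: ifP => _.
  apply: le_trans E1 _.
  have -> : 7 / 20 * (3 / (8 * (k * J)) * (N%:R * z)) =
      21 / 20 * (N%:R * z / (8 * (k * J))) by field; rewrite ?gt_eqF.
  have : 0 < N%:R * z / (8 * (k * J)) by rewrite divr_gt0// mulr_gt0.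
  lra.
apply: le_trans E2 _.
have -> : 7 / 20 * (3 * rho * (N%:R * z) / (64 * (N%:R * Rs * (k * J) ^+ 2)) * (N%:R * z)) =
    21 / 20 * (rho * (N%:R * z) ^+ 2 / (64 * (N%:R * Rs * (k * J) ^+ 2))).
  by field; rewrite ?gt_eqF.
have : 0 < rho * (N%:R * z) ^+ 2 / (64 * (N%:R * Rs * (k * J) ^+ 2)).
  by rewrite divr_gt0 ?mulr_gt0// exprn_gt0.
lra.
Qed.

Theorem theorem3p7
  (R : realType) (d : nat)
  (* state spaces S_N of X^N and the closed set hat S *)
  (S : nat -> set 'rV[int]_d) (Shat : set 'rV[R]_d)
  (* the finite set of jumps and the rate functions r_J *)
  (Js : seq 'rV[int]_d) (r : 'rV[int]_d -> 'rV[R]_d -> R)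
  (c : 'rV[R]_d) (rho : R) (M : 'M[R]_d) (delta0 delta1 r0 : R)
  (HShat_closed : closed Shat)
  (HSN : forall (N : nat) (X : 'rV[int]_d), (0 < N)%N -> S N X ->
           Shat ((N%:R)^-1 *: intr_vec R X))
  (* Assumption 1 *)
  (HJs_uniq : uniq Js)
  (Hr_nonneg : forall J y, J \in Js -> Shat y -> 0 <= r J y)
  (Hr_diff : forall J y, J \in Js -> Shat y -> differentiable (r J) y)
  (Hr_C1 : forall J (i : 'I_d), J \in Js ->
           {within Shat, continuous (fun y => 'D_(delta_mx 0 i) (r J) y)})
  (* X^N is a process on S_N: jumps of positive rate stay in S_N *)
  (HjumpsSN : forall (N : nat) X J, (0 < N)%N -> S N X -> J \in Js ->
           0 < r J ((N%:R)^-1 *: intr_vec R X) -> S N (X + J))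
  (* Assumption 2 *)
  (HJs_gen : forall v : 'rV[int]_d, exists s : seq 'rV[int]_d,
           (forall J, J \in s -> J \in Js) /\ v = \sum_(J <- s) J)
  (* Assumption 3 *)
  (Hc_int : (interior Shat) c)
  (HFc : driftF Js r c = 0)
  (Hrc : forall J, J \in Js -> 0 < r J c)
  (Hrho : 0 < rho)
  (Heig : forall l : R[i], is_eigenvalue (gradmat Js r c) l -> complex.Re l < - rho)
  (* M and delta0 *)
  (HMsym : M^T = M)
  (HMpd : forall x : 'rV[R]_d, x != 0 -> 0 < (x *m M *m x^T) 0 0)
  (Hdelta0 : 0 < delta0)
  (Hball0 : ballM M c delta0 `<=` Shat)
  (Hcontr1 : forall y : R -> 'rV[R]_d, is_ode_sol (driftF Js r) y ->
       mnorm M (y 0 - c) <= delta0 ->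
       forall t, 0 < t -> contracts rho (fun s => mnorm M (y s - c)) t)
  (Hcontr2 : forall y z : R -> 'rV[R]_d,
       is_ode_sol (driftF Js r) y -> mnorm M (y 0 - c) <= delta0 ->
       is_ode_sol (driftF Js r) z -> mnorm M (z 0 - c) <= delta0 ->
       forall t, 0 < t -> contracts rho (fun s => mnorm M (y s - z s)) t)
  (* delta1 and r0 *)
  (Hdelta1 : 0 < delta1) (Hdelta10 : delta1 <= delta0) (Hr0 : 0 < r0)
  (Hr0ball : forall J y, J \in Js -> ballM M c delta1 y -> r0 < r J y)
  (* the claim *)
  (N : nat) (HN : (0 < N)%N) (z delta : R)
  (Hz : 0 < z) (Hzdelta : z < delta) (Hdelta : delta <= delta1)
  (pi : 'rV[int]_d -> R)
  (Hpi : is_stationary (Xset S M c N delta) (rate Js r N) pi) :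
  \sum_(X \in Xset S M c N delta `&`
          [set X | ~ ballM M (N%:R *: c) (N%:R * z) (intr_vec R X)]) pi X
    <= 2 * zetahat Js r M c rho delta0 N (z * (1 - expR (- (1/2))) / (2 * c1 M)).
Proof.
case: d => [|n] in S Shat Js r c M HShat_closed HSN Hr_nonneg Hr_diff Hr_C1
  HjumpsSN HJs_gen Hc_int HFc Hrc Heig HMsym HMpd Hball0 Hcontr1 Hcontr2
  Hr0ball pi Hpi HJs_uniq *.
  rewrite /zetahat /zeta mulr0 !mul0r mulr0.
  have -> : Xset S M c N delta `&`
      [set X | ~ ballM M (N%:R *: c) (N%:R * z) (intr_vec R X)] = set0.
    apply/seteqP; split => // X [_]; apply; rewrite /ballM/=.
    have -> : intr_vec R X - N%:R *: c = 0 by apply/rowP => -[].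
    by rewrite mnorm0 mulr_ge0// ltW.
  by rewrite fsbig_set0.
apply: (@stationary_concentration R n S Shat Js r c rho M delta0 Hr_nonneg Hr_diff
  HjumpsSN HJs_gen HFc Hrc Hrho Heig HMsym HMpd Hdelta0 Hball0 Hcontr1 N z delta) => //.
exact: le_trans Hdelta Hdelta10.
Qed.
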